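(* Let $(\Phi,\phi)$ be a symmetric couple of types, $F$ an $R$-module of type $\Phi$ with finitely many submodules, and $\mathcal H_\phi=\mathrm{End}_G(\mathcal F_\phi)$ where $G=\mathrm{Aut}_R(F)$. For every $\lambda\le\phi$ the subspaces $\mathcal H_\phi^{\lambda}$ and $\mathcal H_\phi^{\lambda^-}$ are ideals of $\mathcal H_\phi$, the quotient $\mathcal K_\lambda=\mathcal H_\phi^{\lambda}/\mathcal H_\phi^{\lambda^-}$ is a one-dimensional representation of $\mathcal H_\phi$, and: (1) $\{\mathcal K_\lambda\}_{\lambda\le\phi}$ forms a complete set of irreducible representations of $\mathcal H_\phi$. (2) For every $\lambda\le\phi$, as $\mathcal H_\phi$-modules, $\mathcal H_\phi^{\lambda}\simeq\bigoplus_{\mu\le\lambda}\mathcal K_\mu$.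
   Context: Let $R$ be a ring; modules are finitely generated left $R$-modules. The type $\tau(x)$ of a module $x$ is its isomorphism class; $\lambda\le\mu$ means that a module of type $\mu$ has a submodule of type $\lambda$. A type $\phi$ is symmetric if for all modules $f,f'$ of type $\phi$, all submodules $x\subseteq f$, $x'\subseteq f'$ and every isomorphism $h:x\to x'$, there is an isomorphism $f\to f'$ extending $h$. For symmetric types $\phi\le\Phi$, $(\Phi,\phi)$ is a symmetric couple if for every module $F$ of type $\Phi$, every $f\subseteq F$ of type $\phi$ and every $\lambda\le\phi$: (i) there is $f'\subseteq F$ with $\tau(f')=\phi$ and $\tau(f\cap f')=\lambda$; (ii) for every $x\subseteq F$ with $\tau(x)\le\phi$, the square formed by $x\cap f$, $x$, $f$, $x+f$ is a pushout, i.e. $x+f\simeq (x\oplus f)/(x\cap f)$ (this holds automatically for modules). For a type $\lambda$, $X_\lambda$ is the set of submodules of $F$ of type $\lambda$, and $\mathcal F_\lambda$ is the space of $\mathbb Q$-valued functions on $X_\lambda$ with $G$-action $[gf](x)=f(g^{-1}x)$. For $\lambda\le\phi$ define $\mathbf T_{\phi\succ\lambda}:\mathcal F_\lambda\to\mathcal F_\phi$ by $(\mathbf T_{\phi\succ\lambda}h)(y)=\sum_{x\in X_\lambda,\,x\subseteq y}h(x)$, $\mathbf T_{\lambda\prec\phi}:\mathcal F_\phi\to\mathcal F_\lambda$ by $(\mathbf T_{\lambda\prec\phi}h)(x)=\sum_{y\in X_\phi,\,y\supseteq x}h(y)$, and $\mathbf c_\lambda=\mathbf T_{\phi\succ\lambda}\mathbf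 T_{\lambda\prec\phi}\in\mathcal H_\phi$. Put $\mathcal H_\phi^{\lambda}=\mathrm{span}_{\mathbb Q}\{\mathbf c_{\lambda'}:\lambda'\le\lambda\}$ and $\mathcal H_\phi^{\lambda^-}=\mathrm{span}_{\mathbb Q}\{\mathbf c_{\lambda'}:\lambda'<\lambda\}$. *)

(* Defs.v *)
From HB Require Import structures.
From mathcomp Require Import all_boot all_algebra.
From mathcomp Require Import finmap boolp classical_sets functions cardinality.

Set Implicit Arguments.
Unset Strict Implicit.
Unset Printing Implicit Defensive.

Import GRing.Theory.
Local Open Scope ring_scope.

Record submodule (R : pzRingType) (V : lmodType R) := Submodule {
  submod_pred :> {pred V};
  submodP : submod_closed submod_pred }.

HB.instance Definition _ (R : pzRingType) (V : lmodType R) :=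
  gen_eqMixin (submodule V).
HB.instance Definition _ (R : pzRingType) (V : lmodType R) :=
  gen_choiceMixin (submodule V).
HB.instance Definition _ (R : pzRingType) (V : lmodType R) (S : submodule V) :=
  GRing.isSubmodClosed.Build R V (submod_pred S)
    (GRing.submod_closed_semi (submodP S)).

Definition submod_of (R : pzRingType) (V : lmodType R) (S : submodule V) : Type :=
  {v : V | v \in submod_pred S}.

HB.instance Definition _ (R : pzRingType) (V : lmodType R) (S : submodule V) :=
  SubChoice.on (submod_of S).
HB.instance Definition _ (R : pzRingType) (V : lmodType R) (S : submodule V) :=
  [SubChoice_isSubLmodule of submod_of S by <:].

Definition submod_lmod (R : pzRingType) (V : lmodType R) (S : submodule V) :
  lmodType R := submod_of S.
Coercion submod_lmod : submodule >-> GRing.Lmodule.type.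

(* The inclusion of a submodule is linear; submodules S of V are used both as
   modules (through submod_lmod) and as subsets of V (through submod_pred). *)
Definition submod_val (R : pzRingType) (V : lmodType R) (S : submodule V) :
  {linear S -> V} := [the {linear submod_of S -> V} of val].

Lemma preim_closed (R : pzRingType) (U V : lmodType R) (f : {linear U -> V})
    (S : submodule V) : submod_closed [pred u : U | f u \in S].
Proof.
split=> [|a u v]; rewrite !inE ?linear0 ?rpred0 // => fu fv.
by rewrite linearP rpredD ?rpredZ.
Qed.

Definition preim_submod (R : pzRingType) (U V : lmodType R)
    (f : {linear U -> V}) (S : submodule V) : submodule U :=
  Submodule (preim_closed f S).

Lemma cap_closed (R : pzRingType) (V : lmodType R) (S T : submodule V) :
  submod_closed [pred v : V | (v \in S) && (v \in T)].
Proof.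
split=> [|a u v]; rewrite !inE ?rpred0 // => /andP[uS uT] /andP[vS vT].
by rewrite !rpredD ?rpredZ.
Qed.

Definition cap_submod (R : pzRingType) (V : lmodType R) (S T : submodule V) :
  submodule V := Submodule (cap_closed S T).

Lemma add_closed (R : pzRingType) (V : lmodType R) (S T : submodule V) :
  submod_closed
    [pred v : V | `[< exists2 s, s \in S & exists2 t, t \in T & v = s + t >]].
Proof.
split=> [|a u v]; rewrite !inE.
  by exists 0; rewrite ?rpred0 //; exists 0; rewrite ?rpred0 ?addr0.
move=> [s sS [t tT ->]] [s' sS' [t' tT' ->]].
exists (a *: s + s'); first by rewrite rpredD ?rpredZ.
exists (a *: t + t'); first by rewrite rpredD ?rpredZ.
by rewrite scalerDr addrACA.
Qed.

Definition add_submod (R : pzRingType) (V : lmodType R) (S T : submodule V) :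
  submodule V := Submodule (add_closed S T).

Section Inclusion.
Variables (R : pzRingType) (V : lmodType R) (S T : submodule V).
Hypothesis sST : {subset S <= T}.

Definition incl_fun (u : S) : T := (Sub (val u) (sST (valP u)) : submod_of T).

Fact incl_is_linear : linear incl_fun.
Proof. by move=> a u v; apply: val_inj. Qed.

HB.instance Definition _ :=
  GRing.isLinear.Build R S T _ incl_fun incl_is_linear.

Definition incl : {linear S -> T} := incl_fun.
End Inclusion.

Definition is_pushout (R : pzRingType) (A B C D : lmodType R)
    (i : {linear A -> B}) (j : {linear A -> C})
    (k : {linear B -> D}) (l : {linear C -> D}) : Prop :=
  k \o i =1 l \o j /\
  forall (M : lmodType R) (u : {linear B -> M}) (v : {linear C -> M}),
    u \o i =1 v \o j ->
    exists w : {linear D -> M},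
      [/\ w \o k =1 u, w \o l =1 v &
          forall w' : {linear D -> M},
            w' \o k =1 u -> w' \o l =1 v -> w' =1 w].

Lemma cap_subl (R : pzRingType) (V : lmodType R) (S T : submodule V) :
  {subset cap_submod S T <= S}.
Proof. by move=> v; rewrite inE => /andP[]. Qed.

Lemma cap_subr (R : pzRingType) (V : lmodType R) (S T : submodule V) :
  {subset cap_submod S T <= T}.
Proof. by move=> v; rewrite inE => /andP[]. Qed.

Lemma sub_addl (R : pzRingType) (V : lmodType R) (S T : submodule V) :
  {subset S <= add_submod S T}.
Proof. by move=> v vS; rewrite inE; exists v => //; exists 0; rewrite ?rpred0 ?addr0. Qed.

Lemma sub_addr (R : pzRingType) (V : lmodType R) (S T : submodule V) :
  {subset T <= add_submod S T}.
Proof. by move=> v vT; rewrite inE; exists 0; rewrite ?rpred0 //; exists v; rewrite ?add0r. Qed.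

Definition lmod_iso (R : pzRingType) (U V : lmodType R) : Prop :=
  exists f : {linear U -> V}, bijective f.

Definition finitely_generated (R : pzRingType) (M : lmodType R) : Prop :=
  exists (n : nat) (g : 'I_n -> M),
    forall m : M, exists a : 'I_n -> R, m = \sum_(i < n) a i *: g i.

(* A type: an isomorphism class of finitely generated modules, given as a
   predicate on modules. *)
Record mtype (R : pzRingType) := MType {
  has_type : lmodType R -> Prop;
  has_typeP : exists2 M : lmodType R,
    finitely_generated M & has_type = lmod_iso M }.

Definition mtype_le (R : pzRingType) (l m : mtype R) : Prop :=
  exists2 M : lmodType R, has_type m M & exists x : submodule M, has_type l x.

Definition mtype_lt (R : pzRingType) (l m : mtype R) : Prop :=
  mtype_le l m /\ l <> m.

Definition symmetric_type (R : pzRingType) (p : mtype R) : Prop :=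
  forall f f' : lmodType R, has_type p f -> has_type p f' ->
  forall (x : submodule f) (x' : submodule f') (h : {linear x -> x'}),
    bijective h ->
    exists2 g : {linear f -> f'}, bijective g &
      forall u : x, g (submod_val x u) = submod_val x' (h u).

Definition symmetric_couple (R : pzRingType) (P p : mtype R) : Prop :=
  [/\ symmetric_type P, symmetric_type p, mtype_le p P &
    forall (F : lmodType R) (f : submodule F) (l : mtype R),
      has_type P F -> has_type p f -> mtype_le l p ->
      (exists2 f' : submodule F, has_type p f' & has_type l (cap_submod f f')) /\
      (forall (x : submodule F) (m : mtype R), has_type m x -> mtype_le m p ->
        is_pushout (incl (@cap_subl _ _ x f)) (incl (@cap_subr _ _ x f))
                   (incl (@sub_addl _ _ x f)) (incl (@sub_addr _ _ x f)))].

Lemma lmod_iso_trans (R : pzRingType) (U V W : lmodType R) :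
  lmod_iso U V -> lmod_iso V W -> lmod_iso U W.
Proof.
move=> [f fbij] [g gbij]; exists (g \o f : {linear U -> W}).
exact: bij_comp gbij fbij.
Qed.

Lemma lmod_iso_sym (R : pzRingType) (U V : lmodType R) :
  lmod_iso U V -> lmod_iso V U.
Proof.
move=> [f [g fK gK]].
have gl : linear g by move=> a u v; apply: (can_inj fK); rewrite gK linearP !gK.
pose gL := GRing.isLinear.Build R V U _ g gl.
exists (HB.pack_for {linear V -> U} g gL); by exists f.
Qed.

Record automorphism (R : pzRingType) (F : lmodType R) := Automorphism {
  aut_fun :> {linear F -> F};
  aut_bij : bijective aut_fun }.

Lemma preim_type (R : pzRingType) (F : lmodType R) (g : automorphism F)
    (l : mtype R) (x : submodule F) :
  has_type l x -> has_type l (preim_submod g x).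
Proof.
case: (has_typeP l) => M _ -> Mx; apply: lmod_iso_trans Mx _.
apply: lmod_iso_sym.
have hP (u : preim_submod g x) : g (val u) \in submod_pred x by exact: (valP u).
pose h (u : preim_submod g x) : x := (Sub (g (val u)) (hP u) : submod_of x).
have hl : linear h by move=> a u v; apply: val_inj; rewrite /= !linearP.
pose hL := GRing.isLinear.Build R (preim_submod g x) x _ h hl.
exists (HB.pack_for {linear preim_submod g x -> x} h hL).
have [k gK kK] := aut_bij g.
have kP (u : x) : k (val u) \in submod_pred (preim_submod g x).
  by rewrite inE kK; exact: (valP u).
exists (fun u : x => (Sub (k (val u)) (kP u) : submod_of (preim_submod g x))).
  by move=> u; apply: val_inj; rewrite /= gK.
by move=> u; apply: val_inj; rewrite /= kK.
Qed.

Section Quotient.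
Variables (R : pzRingType) (V : lmodType R) (S : submodule V).

Definition quot_of : Type := Quotient.quot (submod_pred S).
HB.instance Definition _ := GRing.Zmodule.on quot_of.

Definition quot_pi (v : V) : quot_of := \pi_(Quotient.quot (submod_pred S))%qT v.
Definition quot_repr (q : quot_of) : V := repr (q : Quotient.quot (submod_pred S)).
Definition quot_scale (a : R) (q : quot_of) : quot_of :=
  quot_pi (a *: quot_repr q).

Lemma quot_reprK (q : quot_of) : quot_pi (quot_repr q) = q.
Proof. exact: reprK. Qed.

Lemma quot_piD : {morph quot_pi : u v / u + v}.
Proof. exact: raddfD. Qed.

Lemma quot_pi_eq (u v : V) : quot_pi u = quot_pi v <-> u - v \in S.
Proof. by rewrite Quotient.idealrBE; split=> [/eqP|/eqP]. Qed.

Lemma quot_scale_pi (a : R) (v : V) :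
  quot_scale a (quot_pi v) = quot_pi (a *: v).
Proof.
apply/quot_pi_eq; rewrite -scalerBr rpredZ //.
by apply/quot_pi_eq; rewrite quot_reprK.
Qed.

Fact quot_scalerA a b v : quot_scale a (quot_scale b v) = quot_scale (a * b) v.
Proof. by rewrite -[v]quot_reprK !quot_scale_pi scalerA. Qed.
Fact quot_scale1r : left_id 1 quot_scale.
Proof. by move=> v; rewrite -[v]quot_reprK quot_scale_pi scale1r. Qed.
Fact quot_scalerDr : right_distributive quot_scale +%R.
Proof.
move=> a u v; rewrite -[u]quot_reprK -[v]quot_reprK -quot_piD !quot_scale_pi.
by rewrite -quot_piD scalerDr.
Qed.
Fact quot_scalerDl v : {morph quot_scale^~ v : a b / a + b}.
Proof.
move=> a b; rewrite -[v]quot_reprK /= !quot_scale_pi -quot_piD.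
by rewrite scalerDl.
Qed.

HB.instance Definition _ := GRing.Zmodule_isLmodule.Build R quot_of
  quot_scalerA quot_scale1r quot_scalerDr quot_scalerDl.

Definition quot_mod : lmodType R := quot_of.
End Quotient.

Section DirectSum.
Variables (R : pzRingType) (n : nat) (V : 'I_n -> lmodType R).

Definition dsum_of : Type := forall i, V i.

HB.instance Definition _ := gen_eqMixin dsum_of.
HB.instance Definition _ := gen_choiceMixin dsum_of.

Definition dsum_zero : dsum_of := fun i => 0.
Definition dsum_add (u v : dsum_of) : dsum_of := fun i => u i + v i.
Definition dsum_opp (u : dsum_of) : dsum_of := fun i => - u i.
Definition dsum_scale (a : R) (u : dsum_of) : dsum_of := fun i => a *: u i.

Fact dsum_addA : associative dsum_add.
Proof. by move=> u v w; apply: functional_extensionality_dep => i; apply: addrA. Qed.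
Fact dsum_addC : commutative dsum_add.
Proof. by move=> u v; apply: functional_extensionality_dep => i; apply: addrC. Qed.
Fact dsum_add0 : left_id dsum_zero dsum_add.
Proof. by move=> u; apply: functional_extensionality_dep => i; apply: add0r. Qed.
Fact dsum_addN : left_inverse dsum_zero dsum_opp dsum_add.
Proof. by move=> u; apply: functional_extensionality_dep => i; apply: addNr. Qed.

HB.instance Definition _ :=
  GRing.isZmodule.Build dsum_of dsum_addA dsum_addC dsum_add0 dsum_addN.

Fact dsum_scalerA a b v : dsum_scale a (dsum_scale b v) = dsum_scale (a * b) v.
Proof. by apply: functional_extensionality_dep => i; apply: scalerA. Qed.
Fact dsum_scale1r : left_id 1 dsum_scale.
Proof. by move=> v; apply: functional_extensionality_dep => i; apply: scale1r. Qed.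
Fact dsum_scalerDr : right_distributive dsum_scale +%R.
Proof. by move=> a u v; apply: functional_extensionality_dep => i; apply: scalerDr. Qed.
Fact dsum_scalerDl v : {morph dsum_scale^~ v : a b / a + b}.
Proof. by move=> a b; apply: functional_extensionality_dep => i; apply: scalerDl. Qed.

HB.instance Definition _ := GRing.Zmodule_isLmodule.Build R dsum_of
  dsum_scalerA dsum_scale1r dsum_scalerDr dsum_scalerDl.

Definition direct_sum : lmodType R := dsum_of.
End DirectSum.

Definition span (R : pzRingType) (V : lmodType R) (A : V -> Prop) : {pred V} :=
  [pred v | `[< forall S : submodule V, (forall a, A a -> a \in S) -> v \in S >]].

Definition irreducible (R : pzRingType) (V : lmodType R) : Prop :=
  (exists v : V, v != 0) /\
  forall S : submodule V, (forall v, v \in S -> v = 0) \/ (forall v, v \in S).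

(* Every irreducible module is isomorphic to exactly one member of the family. *)
Definition complete_irreducibles (R : pzRingType) (I : Type)
    (V : I -> lmodType R) : Prop :=
  [/\ forall i, irreducible (V i),
      forall i j, lmod_iso (V i) (V j) -> i = j &
      forall W : lmodType R, irreducible W -> exists i, lmod_iso W (V i)].

Definition two_sided_ideal (A : pzRingType) (I : {pred A}) : Prop :=
  submod_closed (I : {pred A^o}) /\ forall x a : A, x \in I -> x * a \in I.

Definition left_submodule (A : pzRingType) (I : {pred A})
    (idealI : two_sided_ideal I) : submodule A^o := Submodule idealI.1.

(* fset_set is the library's conversion of a finite set; it would return the
   empty set if F had infinitely many submodules of type l. *)
Definition submods (R : pzRingType) (F : lmodType R) (l : mtype R) :
  {fset submodule F} := fset_set [set x : submodule F | has_type l x]%classic.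

Definition submod_fun (R : pzRingType) (F : lmodType R) (l : mtype R) :=
  {ffun submods F l -> rat^o}.

Definition sub_le (R : pzRingType) (V : lmodType R) (x y : submodule V) : bool :=
  `[< {subset x <= y} >].

Section Operators.
Variables (R : pzRingType) (F : lmodType R).
Implicit Types (l p : mtype R) (g : automorphism F).

Lemma preim_submods g l (x : submods F l) :
  preim_submod g (val x) \in submods F l.
Proof.
have := valP x; rewrite /submods; move: (val x) => {x} x.
have [fin|inf] := pselect (finite_set [set x : submodule F | has_type l x]%classic).
  by rewrite !in_fset_set // !inE; exact: preim_type.
by rewrite /fset_set; case: pselect.
Qed.

(* g^-1 x, as the preimage of x by g. *)
Definition aut_inv g l (x : submods F l) : submods F l := [` preim_submods g x]%fset.

Definition aut_act g l (f : submod_fun F l) : submod_fun F l :=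
  [ffun x => f (aut_inv g x)].

Lemma sub_le_aut_inv g l p (x : submods F l) (y : submods F p) :
  sub_le (val (aut_inv g x)) (val (aut_inv g y)) = sub_le (val x) (val y).
Proof.
have [k gK kK] := aut_bij g.
apply/asboolP/asboolP => /= sxy u; last by rewrite !inE; exact: sxy.
by move=> ux; have := sxy (k u); rewrite !inE kK; apply.
Qed.

Lemma sub_le_anti (x y : submodule F) : sub_le x y -> sub_le y x -> x = y.
Proof.
case: x y => [x xP] [y yP] /asboolP xy /asboolP yx.
have exy : x = y.
  by apply: funext => u; apply/idP/idP => [/xy|/yx].
by move: yP xy yx; rewrite -exy => yP _ _; congr Submodule; exact: Prop_irrelevance.
Qed.

Lemma aut_inv_bij g l : bijective (@aut_inv g l).
Proof.
apply: injF_bij => x y exy; apply: val_inj.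
by apply: sub_le_anti; rewrite -(sub_le_aut_inv g) exy; apply/asboolP.
Qed.

Definition T_succ_fun p l (h : submod_fun F l) : submod_fun F p :=
  [ffun y => \sum_(x : submods F l | sub_le (val x) (val y)) h x].

Definition T_prec_fun l p (h : submod_fun F p) : submod_fun F l :=
  [ffun x => \sum_(y : submods F p | sub_le (val x) (val y)) h y].

Fact T_succ_is_linear p l : linear (@T_succ_fun p l).
Proof.
move=> a u v; apply/ffunP => y; rewrite !ffunE scaler_sumr -big_split /=.
by apply: eq_bigr => x _; rewrite !ffunE.
Qed.

Fact T_prec_is_linear l p : linear (@T_prec_fun l p).
Proof.
move=> a u v; apply/ffunP => y; rewrite !ffunE scaler_sumr -big_split /=.
by apply: eq_bigr => x _; rewrite !ffunE.
Qed.

HB.instance Definition _ p l := GRing.isLinear.Build rat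
  (submod_fun F l) (submod_fun F p) _ (@T_succ_fun p l) (@T_succ_is_linear p l).
HB.instance Definition _ l p := GRing.isLinear.Build rat
  (submod_fun F p) (submod_fun F l) _ (@T_prec_fun l p) (@T_prec_is_linear l p).

Definition T_succ p l : 'Hom(submod_fun F l, submod_fun F p) :=
  linfun (@T_succ_fun p l).
Definition T_prec l p : 'Hom(submod_fun F p, submod_fun F l) :=
  linfun (@T_prec_fun l p).

Lemma T_succ_equivariant p l g h :
  T_succ p l (aut_act g h) = aut_act g (T_succ p l h).
Proof.
rewrite !lfunE; apply/ffunP => y; rewrite !ffunE.
rewrite [RHS](reindex (@aut_inv g l)) /=; last exact/onW_bij/aut_inv_bij.
apply: eq_big => [x|x _]; last by rewrite ffunE.
exact/esym/sub_le_aut_inv.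
Qed.

Lemma T_prec_equivariant l p g h :
  T_prec l p (aut_act g h) = aut_act g (T_prec l p h).
Proof.
rewrite !lfunE; apply/ffunP => y; rewrite !ffunE.
rewrite [RHS](reindex (@aut_inv g p)) /=; last exact/onW_bij/aut_inv_bij.
apply: eq_big => [x|x _]; last by rewrite ffunE.
exact/esym/sub_le_aut_inv.
Qed.

Definition equivariant p : {pred 'End(submod_fun F p)} :=
  [pred h : 'End(submod_fun F p) |
    `[< forall g (f : submod_fun F p), h (aut_act g f) = aut_act g (h f) >]].
Arguments equivariant p _ : clear implicits.

Lemma equivariantP p (h : 'End(submod_fun F p)) :
  reflect (forall g f, h (aut_act g f) = aut_act g (h f)) (h \in equivariant p).
Proof. exact: asboolP. Qed.

Lemma aut_act_linear g l : linear (@aut_act g l).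
Proof. by move=> a u v; apply/ffunP => x; rewrite !ffunE. Qed.

HB.instance Definition _ g l := GRing.isLinear.Build rat
  (submod_fun F l) (submod_fun F l) _ (@aut_act g l) (@aut_act_linear g l).

Fact equivariant_closed p : submod_closed (equivariant p).
Proof.
split=> [|a u v /equivariantP eu /equivariantP ev]; apply/equivariantP => g f.
  by rewrite !zero_lfunE linear0.
by rewrite !lfun_simp eu ev linearP.
Qed.

HB.instance Definition _ p := GRing.isSubmodClosed.Build rat
  'End(submod_fun F p) (equivariant p)
  (GRing.submod_closed_semi (equivariant_closed p)).

End Operators.
Arguments equivariant {R} F p _.

(* End_G(F_p), with composition as product. *)
Definition hecke (R : pzRingType) (F : lmodType R) (p : mtype R) : Type :=
  {h : 'End(submod_fun F p) | h \in equivariant F p}.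

Section Hecke.
Variables (R : pzRingType) (F : lmodType R) (p : mtype R).

HB.instance Definition _ := SubChoice.on (hecke F p).
HB.instance Definition _ := [SubChoice_isSubLmodule of hecke F p by <:].

Fact hecke_one_subproof : \1%VF \in equivariant F p.
Proof. by apply/equivariantP => g f; rewrite !id_lfunE. Qed.
Definition hecke_one : hecke F p := Sub \1%VF hecke_one_subproof.

Fact hecke_mul_subproof (h k : hecke F p) :
  (val h \o val k)%VF \in equivariant F p.
Proof.
case: h k => [h /equivariantP eh] [k /equivariantP ek] /=.
by apply/equivariantP => g f; rewrite !comp_lfunE ek eh.
Qed.
Definition hecke_mul (h k : hecke F p) : hecke F p :=
  Sub (val h \o val k)%VF (hecke_mul_subproof h k).

Fact hecke_mulA : associative hecke_mul.
Proof. by move=> h k l; apply: val_inj; apply: comp_lfunA. Qed.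
Fact hecke_mul1l : left_id hecke_one hecke_mul.
Proof. by move=> h; apply: val_inj; apply: comp_lfun1l. Qed.
Fact hecke_mul1r : right_id hecke_one hecke_mul.
Proof. by move=> h; apply: val_inj; apply: comp_lfun1r. Qed.
Fact hecke_mulDl : left_distributive hecke_mul +%R.
Proof. by move=> h k l; apply: val_inj; apply: comp_lfunDl. Qed.
Fact hecke_mulDr : right_distributive hecke_mul +%R.
Proof. by move=> h k l; apply: val_inj; apply: comp_lfunDr. Qed.

HB.instance Definition _ := GRing.Zmodule_isPzRing.Build (hecke F p)
  hecke_mulA hecke_mul1l hecke_mul1r hecke_mulDl hecke_mulDr.

Fact hecke_c_subproof (l : mtype R) :
  (T_succ F p l \o T_prec F l p)%VF \in equivariant F p.
Proof.
apply/equivariantP => g f.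
by rewrite !comp_lfunE T_prec_equivariant T_succ_equivariant.
Qed.

Definition hecke_c (l : mtype R) : hecke F p :=
  Sub (T_succ F p l \o T_prec F l p)%VF (hecke_c_subproof l).

Definition hecke_le (l : mtype R) : {pred hecke F p} :=
  span (fun h => exists2 m, mtype_le m l & h = hecke_c m).

Definition hecke_lt (l : mtype R) : {pred hecke F p} :=
  span (fun h => exists2 m, mtype_lt m l & h = hecke_c m).

(* A rational q acts on a module over hecke F p through q *: 1. *)
Definition one_dimensional (V : lmodType (hecke F p)) : Prop :=
  exists2 v : V, v != 0 & forall w : V, exists q : rat, w = (q *: (1 : hecke F p)) *: v.

End Hecke.
Arguments hecke_c {R} F p l.
Arguments hecke_le {R} F p l _.
Arguments hecke_lt {R} F p l _.

(* T / S for submodules S, T of V; S is replaced by its trace on T. *)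
Definition subquotient (R : pzRingType) (V : lmodType R) (T S : submodule V) :
  lmodType R := quot_mod (preim_submod (submod_val T) S).

Definition types_below (R : pzRingType) (p : mtype R) : Type :=
  {l : mtype R | mtype_le l p}.

(* Main.v *)
From HB Require Import structures.
Require Import Defs.
From mathcomp Require Import all_boot all_algebra.
From mathcomp Require Import finmap boolp classical_sets cardinality.

Set Implicit Arguments.
Unset Strict Implicit.
Unset Printing Implicit Defensive.

Import GRing.Theory Num.Theory.
Local Open Scope ring_scope.

(** Why the theorem holds.  Let [X] be the set of submodules of [F] of type
    [phi].  An operator of the Hecke algebra is given by its kernel, a function
    of pairs in [X] invariant under [G = Aut F].

    Orbits.  An isomorphism between submodules of two modules of type [phi]
    extends to these modules, and an isomorphism between submodules of [F]
    extends to [F].  Hence [G] is transitive on the flags [x <= f] with [f] in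
    [X] and [x] of a given type ([flag_orbit]).  If [f1] and [f2] in [X] meet
    [x] in the same submodule and the type of [x] is below [phi], the pushout
    property glues the identity of [x] with an isomorphism [f1 -> f2], and some
    element of [G] preserves [x] and carries [f1] to [f2] ([glue_orbit]).

    Ideals.  Let [h] be in the Hecke algebra and [l <= phi].  The kernel of
    [h \o T_succ] at [(f, x)] depends only on [x] and [cap x f], by
    [glue_orbit], and Moebius inversion in the lattice of submodules writes it
    as a sum over the submodules [w] of [cap x f].  After composition with
    [T_prec], the coefficient of [w] in the kernel at [(f, f')] is a function
    of the flag [w <= f'], hence of the type of [w] by [flag_orbit].  Therefore
    [h * c_l] is a combination of the [c_m] with [m <= l]
    ([hecke_mul_c_span]).  The case [l = phi], where [c_phi = 1], shows that
    the [c_m] span; they are independent by triangularity, since condition (i)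
    provides pairs with intersection of any given type ([rep_c_free]).

    Blocks.  The kernel of [c_m] counts the submodules of type [m] of
    [cap f f'], so it is symmetric, and so is every kernel.  As the transpose
    reverses products, the Hecke algebra is commutative, and it has no
    nilpotent elements because a symmetric rational matrix of square zero is
    zero.  In a reduced commutative algebra with a basis indexed by a finite
    poset such that each down-set spans an ideal, every such ideal has an
    identity ([ideal_id]).  The difference [e i] of the identities of the
    ideals below and strictly below [i] is an idempotent on which the algebra
    acts through a character [chi i]; the [e i] are orthogonal with sum [1],
    and the ideal of a down-set [D] is the common annihilator of the [e j] with
    [j] outside [D] ([triangular_idempotents], [hecke_blocks]).

    Modules.  The quotient [K i] is then a line with character [chi i],
    generated by the class of [e i].  Lines are classified by their characters,
    the [chi i] are distinct since [chi i (e j)] is the Kronecker symbol, an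
    irreducible module is a line because some [e i] does not kill it, and
    [h |-> (h * e j)] splits an ideal into the lines of its down-set. *)

(** * Types, submodules and finite generation *)

Lemma lmod_iso_of_bij (R : pzRingType) (U V : lmodType R) (f : U -> V) :
  linear f -> injective f -> (forall v, exists u, f u = v) -> lmod_iso U V.
Proof.
move=> fl fI /choice[g gK].
pose fL := GRing.isLinear.Build R U V _ f fl.
exists (HB.pack_for {linear U -> V} f fL); exists g => // u.
by apply: fI; rewrite gK.
Qed.

(** The element [v] of the ambient module, seen in the module [S]. *)
Definition submod_elt (R : pzRingType) (M : lmodType R) (S : submodule M) v
    (vS : v \in S) : S := (Sub v vS : submod_of S).

Section Types.
Variable R : pzRingType.
Implicit Types (l m : mtype R) (M N : lmodType R).

Lemma lmod_iso_refl M : lmod_iso M M.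
Proof. by exists idfun; exists idfun. Qed.

Lemma has_type_eq l M : has_type l M -> has_type l = lmod_iso M.
Proof.
case: (has_typeP l) => M0 _ -> M0M; apply/funext => N; apply/propext.
split; last exact: lmod_iso_trans.
by apply: lmod_iso_trans; apply: lmod_iso_sym.
Qed.

Lemma has_type_iso l M N : has_type l M -> lmod_iso M N -> has_type l N.
Proof. by move=> /has_type_eq->. Qed.

Lemma iso_has_type l M N : has_type l M -> has_type l N -> lmod_iso M N.
Proof. by move=> /has_type_eq->. Qed.

Lemma has_type_inj l m M : has_type l M -> has_type m M -> l = m.
Proof.
move=> /has_type_eq lM /has_type_eq; rewrite -lM => {lM M}.
case: l m => [l lP] [m mP] /= ml; move: mP; rewrite ml => mP.
by congr MType; apply: Prop_irrelevance.
Qed.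

Lemma img_closed M N (f : {linear M -> N}) (S : submodule M) :
  submod_closed [pred v : N | `[< exists2 u, u \in S & v = f u >]].
Proof.
split=> [|a u v]; rewrite !inE; first by exists 0; rewrite ?rpred0 ?linear0.
move=> [s sS ->] [t tS ->]; exists (a *: s + t); last by rewrite linearP.
by rewrite rpredD ?rpredZ.
Qed.

(** The image of a submodule by a linear map. *)
Definition img_submod M N (f : {linear M -> N}) (S : submodule M) :
  submodule N := Submodule (img_closed f S).

Lemma img_submodP M N (f : {linear M -> N}) (S : submodule M) v :
  v \in img_submod f S <-> exists2 u, u \in S & v = f u.
Proof. by rewrite inE. Qed.

Lemma img_submod_iso M N (f : {linear M -> N}) (S : submodule M) :
  injective f -> lmod_iso S (img_submod f S).
Proof.
move=> fI.
have fS (u : S) : f (val u) \in img_submod f S.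
  by apply/img_submodP; exists (val u) => //; apply: valP.
apply: (@lmod_iso_of_bij R S (img_submod f S)
  (fun u : S => Sub (f (val u)) (fS u) : submod_of (img_submod f S))).
- by move=> a u v; apply: val_inj; rewrite /= !linearP.
- by move=> u v /(congr1 val) /= /fI /val_inj.
move=> v; have /img_submodP[u uS vu] := valP v.
by exists (submod_elt uS); apply: val_inj.
Qed.

Lemma submod_eq M (S T : submodule M) : S =i T -> S = T.
Proof. by move=> ST; apply: sub_le_anti; apply/asboolP => v; rewrite ST. Qed.

(** A submodule [S] of [M] contained in [T] is isomorphic to [S] seen as a
    submodule of the module [T]. *)
Lemma trace_iso M (S T : submodule M) : {subset S <= T} ->
  lmod_iso (preim_submod (submod_val T) S) S.
Proof.
move=> sST; have -> : lmod_iso (preim_submod (submod_val T) S) S =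
    lmod_iso (preim_submod (submod_val T) S)
      (img_submod (submod_val T) (preim_submod (submod_val T) S)).
  congr lmod_iso; congr submod_lmod; apply: submod_eq => v.
  apply/idP/idP => [vS|/img_submodP[u uS ->]]; last exact: uS.
  by apply/img_submodP; exists (submod_elt (sST v vS)).
exact/img_submod_iso/val_inj.
Qed.

(** The comparison of types may be tested on any module of the larger type. *)
Lemma mtype_leP l m M : has_type m M ->
  mtype_le l m <-> exists x : submodule M, has_type l x.
Proof.
move=> mM; split=> [[N mN [x lx]]|[x lx]]; last by exists M => //; exists x.
have [f /bij_inj fI] := iso_has_type mN mM.
by exists (img_submod f x); apply: (has_type_iso lx (img_submod_iso _ fI)).
Qed.

Lemma mtype_le_sub l m M (y : submodule M) : has_type m y ->
  mtype_le l m <-> exists2 x : submodule M, {subset x <= y} & has_type l x.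
Proof.
move=> my; rewrite (mtype_leP l my); split=> [[x lx]|[x xy lx]].
  exists (img_submod (submod_val y) x).
    by move=> v /img_submodP[u _ ->]; apply: valP.
  apply: (has_type_iso lx); apply: img_submod_iso; exact: val_inj.
exists (preim_submod (submod_val y) x); apply: (has_type_iso lx).
exact/lmod_iso_sym/trace_iso.
Qed.

Lemma mtype_le_trans l m n : mtype_le l m -> mtype_le m n -> mtype_le l n.
Proof.
move=> lm [N nN [y my]]; apply/(mtype_leP _ nN).
by move/(mtype_le_sub _ my): lm => [x _ lx]; exists x.
Qed.

Lemma mtype_le_refl l : mtype_le l l.
Proof.
have [M _ lM] := has_typeP l.
have lMM : has_type l M by rewrite lM; apply: lmod_iso_refl.
have idP : submod_closed [pred v : M | true] by split.
apply/(mtype_leP _ lMM); exists (img_submod idfun (Submodule idP)).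
apply: (has_type_iso lMM); apply: lmod_iso_sym.
apply: (@lmod_iso_of_bij R _ M
  (fun u : img_submod idfun (Submodule idP) => val u)).
- by [].
- exact: val_inj.
move=> v; have vI : v \in img_submod idfun (Submodule idP).
  by apply/img_submodP; exists v.
by exists (submod_elt vI).
Qed.

Lemma cyclic_closed M (v : M) :
  submod_closed [pred u : M | `[< exists a, u = a *: v >]].
Proof.
split=> [|a x y]; rewrite !inE; first by exists 0; rewrite scale0r.
by move=> [b ->] [d ->]; exists (a * b + d); rewrite scalerDl scalerA.
Qed.

(** The cyclic submodules of a submodule [x], being finite in number, give
    finitely many generators of [x]. *)
Lemma finite_submods_fg M (x : submodule M) :
  finite_set [set: submodule M]%classic -> finitely_generated x.
Proof.
move=> finM; pose cyc v : submodule M := Submodule (cyclic_closed v).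
pose E : seq (submodule M) := fset_set [set: submodule M]%classic.
have inE' y : y \in E by rewrite in_fset_set // inE.
have /choice[g gP] : forall i : 'I_(size E), exists u : x,
    forall v : x, nth (cyc 0) E i = cyc (val v) -> cyc (val v) = cyc (val u).
  move=> i; have [[u Eu]|Nu] :=
    pselect (exists u : x, nth (cyc 0) E i = cyc (val u)).
    by exists u => v; rewrite Eu.
  by exists 0 => v Ev; case: Nu; exists v.
exists (size E), g => v.
have lti : (index (cyc (val v)) E < size E)%N by rewrite index_mem.
pose i := Ordinal lti.
have : val v \in cyc (val (g i)).
  by rewrite -(gP i v) ?nth_index // inE; exists 1; rewrite scale1r.
rewrite inE => -[a va]; exists (fun j => if j == i then a else 0).
apply: val_inj; rewrite (bigD1 i) //= eqxx va big1 ?addr0 // => j /negPf->.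
by rewrite scale0r.
Qed.

Lemma submod_type_subproof M (x : submodule M) :
  finite_set [set: submodule M]%classic ->
  exists2 N : lmodType R, finitely_generated N & lmod_iso x = lmod_iso N.
Proof. by exists x => //; apply: finite_submods_fg. Qed.

(** The isomorphism class of a submodule, which is a type because there are
    finitely many submodules. *)
Definition submod_type M (finM : finite_set [set: submodule M]%classic)
  (x : submodule M) : mtype R := MType (submod_type_subproof x finM).

Lemma submod_typeP M finM (x : submodule M) : has_type (submod_type finM x) x.
Proof. exact: lmod_iso_refl. Qed.

Lemma submod_typeE M finM l (x : submodule M) :
  has_type l x <-> submod_type finM x = l.
Proof.
by split=> [/(has_type_inj (submod_typeP _ x))|<-]; last exact: submod_typeP.
Qed.

End Types.

(** * Orbits of the automorphism group *)

Section Orbits.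
Variables (R : pzRingType) (F : lmodType R).
Implicit Types (x f : submodule F) (g : automorphism F).

(** An automorphism acts on submodules through inverse images, so
    [preim_submod g x' = x] expresses that [g] carries [x] onto [x']. *)
Lemma preim_submod_eq g x x' :
  (forall v, v \in x -> g v \in x') ->
  (forall v', v' \in x' -> exists2 v, v \in x & g v = v') ->
  preim_submod g x' = x.
Proof.
move=> xx' x'x; apply: submod_eq => v; rewrite [LHS]inE.
apply/idP/idP => [/x'x[u ux /(bij_inj (aut_bij g))<-//]|]; exact: xx'.
Qed.

Variables (Phi phi : mtype R).
Hypotheses (couple : symmetric_couple Phi phi) (typeF : has_type Phi F).

Lemma aut_extension x x' (h : {linear x -> x'}) : bijective h ->
  exists g : automorphism F, forall u : x, g (val u) = val (h u).
Proof.
move=> hbij; have [symPhi _ _ _] := couple.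
have [g gbij gh] := symPhi F F typeF typeF x x' h hbij.
by exists (Automorphism gbij).
Qed.

Lemma iso_orbit x x' : lmod_iso x x' ->
  exists g : automorphism F, preim_submod g x' = x.
Proof.
move=> [h hbij]; have [g gh] := aut_extension hbij; exists g.
apply: preim_submod_eq => [v vx|v' vx'].
  by rewrite (gh (submod_elt vx)); apply: valP.
have [k hK kK] := hbij; pose u' : x' := submod_elt vx'.
by exists (val (k u')); [apply: valP|rewrite gh kK].
Qed.

(** [Aut F] acts transitively on the flags [x <= f] with [f] of type [phi]
    and [x] of a given type. *)
Lemma flag_orbit l x x' f f' :
  has_type phi f -> has_type phi f' -> {subset x <= f} -> {subset x' <= f'} ->
  has_type l x -> has_type l x' ->
  exists g : automorphism F, preim_submod g x' = x /\ preim_submod g f' = f.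
Proof.
move=> phif phif' xf xf' lx lx'.
have [_ symphi _ _] := couple.
have [h hbij] : lmod_iso (preim_submod (submod_val f) x)
    (preim_submod (submod_val f') x').
  apply: lmod_iso_trans (trace_iso xf) _.
  apply: lmod_iso_trans (iso_has_type lx lx') _.
  exact/lmod_iso_sym/trace_iso.
have [k kbij kh] := symphi f f' phif phif' _ _ h hbij.
have [g gk] := aut_extension kbij; exists g; split; apply: preim_submod_eq.
- move=> v vx; pose t : f := submod_elt (xf v vx).
  have tx : t \in preim_submod (submod_val f) x by [].
  rewrite (gk t) -[t]/(submod_val _ (submod_elt tx)).
  by rewrite kh; apply: (valP (h _)).
- move=> v' vx'; pose t' : f' := submod_elt (xf' v' vx').
  have tx' : t' \in preim_submod (submod_val f') x' by [].
  have [i hK iK] := hbij.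
  pose s := i (submod_elt tx').
  by exists (val (val s)); [apply: (valP s)|rewrite gk kh iK].
- by move=> v vf; rewrite (gk (submod_elt vf)); apply: valP.
move=> v' vf'; have [i kK iK] := kbij.
pose u' : f' := submod_elt vf'.
by exists (val (i u')); [apply: valP|rewrite gk iK].
Qed.

(** The pushout condition: an isomorphism between [f1] and [f2] that is the
    identity on their common intersection with [x] glues with the identity of
    [x] to an isomorphism between [x + f1] and [x + f2], which extends to
    [F]. *)
Lemma glue_orbit m x f1 f2 :
  has_type m x -> mtype_le m phi -> has_type phi f1 -> has_type phi f2 ->
  cap_submod x f1 = cap_submod x f2 ->
  exists g : automorphism F, preim_submod g x = x /\ preim_submod g f2 = f1.
Proof.
move=> mx mphi phif1 phif2 capE.
have capP v : v \in x -> (v \in f1) = (v \in f2).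
  by move=> vx; move: (congr1 (fun S : submodule F => v \in S) capE);
     rewrite /= !inE vx.
have [_ symphi _ coupleF] := couple.
pose P1 := preim_submod (submod_val f1) x.
pose P2 := preim_submod (submod_val f2) x.
have sub2 (u : P1) : val (val u) \in f2.
  by rewrite -capP; [apply: (valP (val u))|apply: (valP u)].
have sub2x (u : P1) : submod_elt (sub2 u) \in P2.
  exact: (valP u).
(* Both [P1] and [P2] are [cap x f1 = cap x f2], and [h] is its identity. *)
pose h (u : P1) : P2 := submod_elt (sub2x u).
have hl : linear h by move=> a u v; do 2!apply: val_inj.
pose hL := GRing.isLinear.Build R P1 P2 _ h hl.
have hbij : bijective (HB.pack_for {linear P1 -> P2} h hL).
  have [|i iK] := @choice P2 P1 (fun v u => h u = v); last first.
    exists i => // u; do 2!apply: val_inj.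
    by rewrite -[RHS]/(val (val (h u))) -[in RHS](iK (h u)).
  move=> v; have sub1 : val (val v) \in f1.
    by rewrite capP; [apply: (valP (val v))|apply: (valP v)].
  have sub1x : submod_elt sub1 \in P1 by apply: (valP v).
  by exists (submod_elt sub1x); do 2!apply: val_inj.
have [k kbij kh] := symphi f1 f2 phif1 phif2 _ _ _ hbij.
have kx (t : f1) : val t \in x -> val (k t) = val t.
  move=> tx; have tP : t \in P1 by [].
  by rewrite -[t in LHS]/(submod_val P1 (submod_elt tP)) kh.
have [_ /(_ x m mx mphi) [_ push]] := coupleF F f1 m typeF phif1 mphi.
have [|w [wx wf _]] := push (add_submod x f2) (incl (@sub_addl _ _ x f2))
    (incl (@sub_addr _ _ x f2) \o k : {linear f1 -> add_submod x f2}).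
  move=> u; apply: val_inj => /=; rewrite kx //.
  by have := valP u; rewrite inE => /andP[].
have wx' v (vx : v \in x) (va : v \in add_submod x f1) :
    val (w (submod_elt va)) = v.
  have /(congr1 val) /= wv := wx (submod_elt vx).
  by rewrite -[RHS]wv; congr (val (w _)); apply: val_inj.
have wf' (t : f1) (va : val t \in add_submod x f1) :
    val (w (submod_elt va)) = val (k t).
  have /(congr1 val) /= wt := wf t.
  by rewrite -[RHS]wt; congr (val (w _)); apply: val_inj.
have addx1 s : s \in x -> s \in add_submod x f1 by apply: sub_addl.
have addf1 (t : f1) : val t \in add_submod x f1 by apply/sub_addr/valP.
have wD s (t : f1) (sx : s \in x) (u : add_submod x f1) :
    val u = s + val t -> val (w u) = s + val (k t).
  move=> ust.
  have -> : u = submod_elt (addx1 s sx) + submod_elt (addf1 t).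
    exact: val_inj.
  by rewrite linearD /= wx' // wf'.
have addE (u : add_submod x f1) :
    exists s (t : f1), s \in x /\ val u = s + val t.
  have := valP u; rewrite inE => -[s sx [t tf ut]].
  by exists s, (submod_elt tf).
have wbij : bijective w.
  have wI : injective w.
    suff w0 u : w u = 0 -> u = 0.
      move=> u u' /eqP; rewrite -subr_eq0 -linearB => /eqP/w0/eqP.
      by rewrite subr_eq0 => /eqP.
    (* If [w (s + t) = s + k t = 0], then [k t] is in [cap x f2], where [k]
       is the identity; so [t = k t] and [s + t = 0]. *)
    move=> wu0; apply: val_inj => /=.
    have [s [t [sx ust]]] := addE u.
    have := wD _ t sx u ust; rewrite wu0 => /esym/eqP.
    rewrite addrC addr_eq0 => /eqP kt.
    have ktx : val (k t) \in x by rewrite kt rpredN.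
    have ktf : val (k t) \in f1 by rewrite capP //; apply: valP.
    have -> : val u = s + val (k t); last by rewrite kt subrr.
    rewrite ust; congr (s + _); apply: (congr1 val (_ : t = submod_elt ktf)).
    by apply: (bij_inj kbij); apply: val_inj; rewrite [RHS]kx.
  have wS v : exists u, w u = v.
    have := valP v; rewrite inE => -[s sx [t tf vst]].
    have [i kK iK] := kbij; pose t' := i (submod_elt tf).
    have sta : s + val t' \in add_submod x f1 by rewrite rpredD // addx1.
    exists (submod_elt sta); apply: val_inj.
    by rewrite (wD s t') // iK /= vst.
  by have [i iK] := choice wS; exists i => // u; apply: wI; rewrite iK.
have [g gw] := aut_extension wbij.
have gx v : v \in x -> g v = v.
  by move=> vx; rewrite (gw (submod_elt (addx1 v vx))) wx'.
have gf (t : f1) : g (val t) = val (k t).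
  by rewrite (gw (submod_elt (addf1 t))) wf'.
exists g; split; apply: preim_submod_eq.
- by move=> v vx; rewrite gx.
- by move=> v vx; exists v => //; apply: gx.
- by move=> v vf; rewrite (gf (submod_elt vf)); apply: valP.
move=> v' vf'; have [i kK iK] := kbij.
pose u' : f2 := submod_elt vf'.
by exists (val (i u')); [apply: valP|rewrite gf iK].
Qed.

End Orbits.

(** * The finite lattice of submodules *)

Section Counting.
Variables (R : pzRingType) (F : lmodType R).
Implicit Types (x y z w : submodule F) (g : automorphism F).

Lemma sub_leP x y : reflect {subset x <= y} (sub_le x y).
Proof. exact: asboolP. Qed.

Lemma sub_le_refl : reflexive (@sub_le R F).
Proof. by move=> x; apply/sub_leP. Qed.

Lemma sub_le_trans : transitive (@sub_le R F).
Proof. by move=> y x z /sub_leP xy /sub_leP yz; apply/sub_leP => v /xy/yz. Qed.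

Lemma sub_le_cap w x y : sub_le w (cap_submod x y) = sub_le w x && sub_le w y.
Proof.
apply/sub_leP/andP => [wxy|[/sub_leP wx /sub_leP wy] v vw].
  by split; apply/sub_leP => v /wxy; rewrite inE => /andP[].
by rewrite inE wx ?wy.
Qed.

Lemma sub_le_preim g x y :
  sub_le (preim_submod g x) (preim_submod g y) = sub_le x y.
Proof.
have [k gK kK] := aut_bij g.
apply/sub_leP/sub_leP => xy u; last by rewrite !inE; apply: xy.
by move=> ux; have := xy (k u); rewrite !inE kK; apply.
Qed.

Lemma preim_submod_inj g : injective (@preim_submod R F F g).
Proof.
move=> x y xy; apply: sub_le_anti; rewrite -(sub_le_preim g) xy;
  exact: sub_le_refl.
Qed.

Lemma preim_cap g x y : preim_submod g (cap_submod x y) =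
  cap_submod (preim_submod g x) (preim_submod g y).
Proof. by apply: submod_eq => v; rewrite !inE. Qed.

Hypothesis finF : finite_set [set: submodule F]%classic.

Definition all_submods : seq (submodule F) :=
  fset_set [set: submodule F]%classic.

Lemma mem_all_submods x : x \in all_submods.
Proof. by rewrite in_fset_set // inE. Qed.

Lemma all_submods_uniq : uniq all_submods.
Proof. exact: fset_uniq. Qed.

Lemma preim_perm g :
  perm_eq [seq preim_submod g x | x <- all_submods] all_submods.
Proof.
have mapU : uniq [seq preim_submod g x | x <- all_submods].
  by rewrite (map_inj_uniq (@preim_submod_inj g)) all_submods_uniq.
apply: uniq_perm => //; first exact: all_submods_uniq.
have mapS : {subset [seq preim_submod g x | x <- all_submods] <= all_submods}.
  by move=> x _; apply: mem_all_submods.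
by have [|//] := uniq_min_size mapU mapS; rewrite size_map.
Qed.

Lemma sum_preim g (P : pred (submodule F)) (G : submodule F -> rat) :
  \sum_(x <- all_submods | P x) G x =
  \sum_(x <- all_submods | P (preim_submod g x)) G (preim_submod g x).
Proof. by rewrite -(perm_big _ (preim_perm g)) /= big_map. Qed.

(** The number of submodules of [x]: strictly monotone and invariant under
    automorphisms, it serves as a length. *)
Definition nsub x : nat := count (fun w => sub_le w x) all_submods.

Lemma nsub_preim g x : nsub (preim_submod g x) = nsub x.
Proof.
rewrite /nsub -(seq.permP (preim_perm g)) count_map.
by apply: eq_count => w; rewrite /= sub_le_preim.
Qed.

Lemma nsub_lt x y : sub_le x y -> x != y -> (nsub x < nsub y)%N.
Proof.
move=> xy xNy; rewrite /nsub -!size_filter.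
rewrite ltnNge; apply: contra xNy => le_size.
have sub_filter : {subset [seq w <- all_submods | sub_le w x] <=
    [seq w <- all_submods | sub_le w y]}.
  move=> w; rewrite !mem_filter => /andP[wx ->].
  by rewrite (sub_le_trans wx xy).
have [|_ eqF] := uniq_min_size _ sub_filter le_size.
  exact/filter_uniq/all_submods_uniq.
apply/eqP/sub_le_anti => //; move: (eqF y).
by rewrite !mem_filter !mem_all_submods sub_le_refl !andbT => ->.
Qed.

Lemma nsub_size x : (nsub x <= size all_submods)%N.
Proof. exact: count_size. Qed.

(** Moebius inversion over the lattice of submodules: the summatory
    transform is invertible, and the inverse transform preserves invariance
    under automorphisms.  The induction is on a bound on [nsub z] below which
    [M t z] vanishes; subtracting [M] from its summatory function raises that
    bound. *)
Lemma equivariant_moebius (T : Type) (act : automorphism F -> T -> T)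
    (M : T -> submodule F -> rat) :
  (forall g t z, M (act g t) (preim_submod g z) = M t z) ->
  exists2 m : T -> submodule F -> rat,
    forall g t z, m (act g t) (preim_submod g z) = m t z &
    forall t z, M t z = \sum_(w <- all_submods | sub_le w z) m t w.
Proof.
pose proper w z := sub_le w z && (w != z).
suff main d : forall M : T -> submodule F -> rat,
    (forall g t z, M (act g t) (preim_submod g z) = M t z) ->
    (forall t z, (nsub z + d <= size all_submods)%N -> M t z = 0) ->
    exists2 m : T -> submodule F -> rat,
      forall g t z, m (act g t) (preim_submod g z) = m t z &
      forall t z, M t z = \sum_(w <- all_submods | sub_le w z) m t w.
  move=> Minv; apply: (main (size all_submods).+1 M) => // t z.
  by rewrite addnC addSn ltnNge leq_addr.
elim: d => [|d IHd] {}M Minv M0.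
  exists (fun _ _ => 0) => // t z.
  by rewrite big1 // M0 // addn0 nsub_size.
have split t z : \sum_(w <- all_submods | sub_le w z) M t w =
    M t z + \sum_(w <- all_submods | proper w z) M t w.
  rewrite big_mkcond (bigD1_seq z) ?mem_all_submods ?all_submods_uniq //=.
  by rewrite sub_le_refl -big_mkcondl.
have [||m minv mE] :=
    IHd (fun t z => \sum_(w <- all_submods | proper w z) M t w).
- move=> g t z; rewrite (sum_preim g); apply: eq_big => w; last by rewrite Minv.
  by rewrite /proper sub_le_preim (inj_eq (@preim_submod_inj g)).
- move=> t z zd; rewrite big1 // => w /andP[wz wNz]; apply: M0.
  by rewrite addnS; apply: leq_trans zd; rewrite ltn_add2r nsub_lt.
exists (fun t z => M t z - m t z) => [g t z|t z]; first by rewrite Minv minv.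
by rewrite sumrB split mE addrK.
Qed.

Lemma mem_submods l x : (x \in submods F l) = `[< has_type l x >].
Proof.
rewrite in_fset_set; last exact: sub_finite_set finF.
by apply/idP/asboolP; rewrite inE.
Qed.

Lemma has_type_le l m x y :
  has_type l x -> has_type m y -> sub_le x y -> mtype_le l m.
Proof.
by move=> lx my /sub_leP xy; apply/(mtype_le_sub _ my); exists x.
Qed.

Lemma sum_submods l (P : pred (submodule F)) (G : submodule F -> rat) :
  \sum_(x : submods F l | P (val x)) G (val x) =
  \sum_(x <- all_submods | `[< has_type l x >] && P x) G x.
Proof.
rewrite -(big_seq_fsetE _ (submods F l) P G) /=.
rewrite -[RHS]big_filter -[LHS]big_filter; apply: perm_big; apply: uniq_perm.
- exact/filter_uniq/fset_uniq.
- exact/filter_uniq/all_submods_uniq.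
by move=> x; rewrite !mem_filter mem_all_submods andbT mem_submods andbC.
Qed.

(** A canonical representative of the isomorphism class of [x] among the
    submodules of [F]. *)
Definition iso_rep x : submodule F := choose (fun y => `[< lmod_iso x y >]) x.

Lemma iso_repP x : lmod_iso x (iso_rep x).
Proof.
apply/asboolP; apply: (@chooseP _ (fun y => `[< lmod_iso x y >])).
exact/asboolP/lmod_iso_refl.
Qed.

Lemma iso_rep_eq x y : lmod_iso x y -> iso_rep x = iso_rep y.
Proof.
move=> xy; rewrite /iso_rep (@choose_id _ _ x y).
- apply: eq_choose => z; apply/asboolP/asboolP; last exact: lmod_iso_trans.
  exact/lmod_iso_trans/lmod_iso_sym.
- exact/asboolP/lmod_iso_refl.
exact/asboolP.
Qed.

End Counting.

(** * Kernels of equivariant operators *)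

Section HeckeAlgebra.
Variables (R : pzRingType) (F : lmodType R).

(** The indicator function of [x]. *)
Definition delta l (x : submods F l) : submod_fun F l :=
  [ffun y => (y == x)%:R].

Lemma deltaE l (x y : submods F l) : delta x y = (y == x)%:R.
Proof. exact: ffunE. Qed.

Lemma sum_delta l (x : submods F l) (G : submods F l -> rat) :
  \sum_y delta x y * G y = G x.
Proof.
rewrite (bigD1 x) //= big1 => [|y /negPf yNx]; last first.
  by rewrite (deltaE x y) yNx mul0r.
by rewrite (deltaE x x) eqxx mul1r addr0.
Qed.

Lemma delta_expansion l p (B : {linear submod_fun F l -> submod_fun F p})
    (u : submod_fun F l) f :
  B u f = \sum_x u x * B (delta x) f.
Proof.
have -> : B u = \sum_x (u x : rat) *: B (delta x).
  rewrite [in LHS](_ : u = \sum_x (u x : rat) *: delta x).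
    by rewrite linear_sum; apply: eq_bigr => x _; rewrite linearZ.
  apply/ffunP => y; rewrite sum_ffunE (bigD1 y) //= big1 => [|x xNy].
    by rewrite !ffunE eqxx addr0 [LHS](esym (mulr1 _)).
  by rewrite !ffunE eq_sym (negPf xNy) scaler0.
by rewrite sum_ffunE; apply: eq_bigr => x _; rewrite !ffunE.
Qed.

Lemma aut_act_delta g l (x : submods F l) :
  aut_act g (delta (aut_inv g x)) = delta x.
Proof.
by apply/ffunP => y; rewrite !ffunE (inj_eq (bij_inj (aut_inv_bij g l))).
Qed.

Lemma T_precE l p (u : submod_fun F p) x :
  T_prec F l p u x = \sum_(y : submods F p | sub_le (val x) (val y)) u y.
Proof. by rewrite lfunE /= ffunE. Qed.

Lemma T_succE p l (u : submod_fun F l) y :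
  T_succ F p l u y = \sum_(x : submods F l | sub_le (val x) (val y)) u x.
Proof. by rewrite lfunE /= ffunE. Qed.

(** The number of submodules of type [l] of [cap_submod f f']. *)
Definition num_common (l : mtype R) (f f' : submodule F) : nat :=
  count (fun w : submodule F =>
    [&& `[< has_type l w >], sub_le w f & sub_le w f']) (all_submods F).

Lemma num_commonC l f f' : num_common l f f' = num_common l f' f.
Proof. by apply: eq_count => w; rewrite [sub_le w f && _]andbC. Qed.

Lemma num_commonE l f f' (q : rat) : q * (num_common l f f')%:R =
  \sum_(w <- all_submods F |
         [&& `[< has_type l w >], sub_le w f & sub_le w f']) q.
Proof. by rewrite big_const_seq iter_addr_0 mulr_natr. Qed.

Variables (Phi phi : mtype R).
Hypotheses (couple : symmetric_couple Phi phi) (typeF : has_type Phi F).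
Hypothesis finF : finite_set [set: submodule F]%classic.

Local Notation X l := (submods F l).
Local Notation E := (all_submods F).
Local Notation A := (hecke F phi).

Lemma has_type_submods l (x : X l) : has_type l (val x).
Proof. by apply/asboolP; rewrite -mem_submods //; apply: valP. Qed.

Lemma num_common_gt0 l (f f' : submodule F) : has_type l (cap_submod f f') ->
  (0 < num_common l f f')%N.
Proof.
move=> lff'; rewrite -has_count; apply/hasP; exists (cap_submod f f').
  exact: mem_all_submods.
by rewrite -sub_le_cap sub_le_refl andbT; apply/asboolP.
Qed.

Lemma hecke_cE l (u : submod_fun F phi) f :
  val (hecke_c F phi l) u f =
  \sum_f' u f' * (num_common l (val f) (val f'))%:R.
Proof.
rewrite /= comp_lfunE T_succE.
rewrite (eq_bigr _ (fun x _ => T_precE u x)).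
rewrite (exchange_big_dep xpredT) //=; apply: eq_bigr => f' _.
rewrite (sum_submods finF l (fun w => sub_le w (val f) && sub_le w (val f'))
  (fun=> u f')).
by rewrite big_const_seq iter_addr_0 mulr_natr.
Qed.

(** The kernel of an operator of the Hecke algebra, as a matrix: its columns
    are the images of the indicator functions. *)
Definition kernel (h : A) (f f' : X phi) : rat := val h (delta f') f.

Lemma kernelE (h : A) (u : submod_fun F phi) f :
  val h u f = \sum_f' u f' * kernel h f f'.
Proof. exact: delta_expansion. Qed.

Lemma kernel_inj (h k : A) :
  (forall f f', kernel h f f' = kernel k f f') -> h = k.
Proof.
move=> hk; apply: val_inj; apply/lfunP => u; apply/ffunP => f.
by rewrite !kernelE; apply: eq_bigr => f' _; rewrite hk.
Qed.

Lemma kernelM (h k : A) f f' :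
  kernel (h * k) f f' = \sum_f'' kernel k f'' f' * kernel h f f''.
Proof. by rewrite {1}/kernel /= comp_lfunE kernelE. Qed.

Lemma kernel_c l f f' :
  kernel (hecke_c F phi l) f f' = (num_common l (val f) (val f'))%:R.
Proof. by rewrite /kernel hecke_cE sum_delta. Qed.

Lemma kernelD (h k : A) f f' :
  kernel (h + k) f f' = kernel h f f' + kernel k f f'.
Proof.
by rewrite /kernel (_ : val (h + k) = val h + val k) // add_lfunE ffunE.
Qed.

Lemma kernelZ q (h : A) f f' : kernel (q *: h) f f' = q * kernel h f f'.
Proof.
by rewrite /kernel (_ : val (q *: h) = q *: val h) // scale_lfunE ffunE.
Qed.

Lemma kernel_sum (I : finType) (P : pred I) (a : I -> rat) (h : I -> A) f f' :
  kernel (\sum_(i | P i) a i *: h i) f f' =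
  \sum_(i | P i) a i * kernel (h i) f f'.
Proof.
rewrite (big_morph (fun h : A => kernel h f f') (id1 := 0) (op1 := +%R)).
- by apply: eq_bigr => i _; rewrite kernelZ.
- by move=> h1 h2; apply: kernelD.
by rewrite -[0 in LHS](scale0r (0 : A)) kernelZ mul0r.
Qed.

(** Isomorphic submodules of [F] have equally many submodules, so neither is
    strictly contained in the other. *)
Lemma sub_same_type l (x y : submodule F) :
  has_type l x -> has_type l y -> sub_le x y -> x = y.
Proof.
move=> lx ly xy; apply/eqP; apply: contraT => /(nsub_lt finF xy).
have [g <-] := iso_orbit couple typeF (iso_has_type lx ly).
by rewrite nsub_preim // ltnn.
Qed.

Lemma mtype_le_Phi l : mtype_le l phi -> exists x : submodule F, has_type l x.
Proof.
have [_ _ phiPhi _] := couple => lphi; apply/(mtype_leP _ typeF).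
exact: mtype_le_trans lphi phiPhi.
Qed.

Lemma mtype_le_anti l m :
  mtype_le l phi -> mtype_le l m -> mtype_le m l -> l = m.
Proof.
move=> /mtype_le_Phi[x lx] lm ml.
have /(mtype_le_sub _ lx)[y yx my] := ml.
have /(mtype_le_sub _ my)[z zy lz] := lm.
have zx : z = x.
  by apply: (sub_same_type lz lx); apply/sub_leP => v /zy/yx.
have xy : x = y.
  by apply: sub_le_anti; apply/sub_leP => //; rewrite -zx.
by apply: has_type_inj lx _; rewrite xy.
Qed.

(** The kernel [M f x = B (delta x) f] of an equivariant operator [B] depends
    on [f] only through [cap x f], by [glue_orbit]; Moebius inversion turns
    it into a sum over the submodules of [cap x f].  After composition with
    [T_prec] and exchange of summations, the coefficient of each submodule
    [w] of [cap f f'] is a function of the flag [w <= f'], hence of the type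
    of [w] alone. *)
Lemma equivariant_factor l
    (B : {linear submod_fun F l -> submod_fun F phi}) :
  mtype_le l phi ->
  (forall g u, B (aut_act g u) = aut_act g (B u)) ->
  exists a : submodule F -> rat,
    (forall x y : submodule F, lmod_iso x y -> a x = a y) /\
    forall u f, B (T_prec F l phi u) f =
      \sum_f' u f' *
        \sum_(w <- E | [&& sub_le w (val f), sub_le w (val f') &
                           `[< exists2 m, has_type m w & mtype_le m l >]]) a w.
Proof.
move=> lphi Bequiv.
pose M (f : X phi) (x : X l) : rat := B (delta x) f.
have Minv g f x : M (aut_inv g f) (aut_inv g x) = M f x.
  by rewrite /M -[in RHS](aut_act_delta g) Bequiv ffunE.
have Mcap f1 f2 x : cap_submod (val x) (val f1) = cap_submod (val x) (val f2) ->
    M f1 x = M f2 x.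
  move=> capE; have [g [gx gf]] := glue_orbit couple typeF (has_type_submods x)
    lphi (has_type_submods f1) (has_type_submods f2) capE.
  have <- : aut_inv g f2 = f1 by apply: val_inj.
  have xg : aut_inv g x = x by apply: val_inj.
  by rewrite -[in LHS]xg Minv.
(* [M' x z] is the common value of [M f x] over the [f] that meet [x] in [z];
   written as an average, it is invariant with no choice of [f], and is [0]
   when there is no such [f]. *)
pose num (x : X l) (z : submodule F) : rat :=
  \sum_(f : X phi | cap_submod (val x) (val f) == z) 1.
pose M' (x : X l) (z : submodule F) : rat :=
  (\sum_(f : X phi | cap_submod (val x) (val f) == z) M f x) / num x z.
have M'inv g x z : M' (aut_inv g x) (preim_submod g z) = M' x z.
  have capE f : (cap_submod (val (aut_inv g x)) (val (aut_inv g f)) ==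
      preim_submod g z) = (cap_submod (val x) (val f) == z).
    by rewrite /= -preim_cap (inj_eq (@preim_submod_inj _ _ g)).
  rewrite /M' /num; congr (_ / _); rewrite (reindex (@aut_inv _ _ g phi)) /=;
    try exact/onW_bij/aut_inv_bij.
    by apply: eq_big => f; [apply: capE|rewrite Minv].
  by apply: eq_bigl => f; apply: capE.
have M'E f x : M' x (cap_submod (val x) (val f)) = M f x.
  rewrite /M' (eq_bigr (fun=> M f x * 1)) => [|f' /eqP/Mcap->]; last first.
    by rewrite mulr1.
  rewrite -mulr_sumr mulfK // lt0r_neq0 // (bigD1 f) //=.
  by rewrite ltr_pwDl ?sumr_ge0.
have [m minv mE] := equivariant_moebius finF M'inv.
(* The coefficient of the submodule [w] in the kernel at [(f, f')]. *)
pose C (w f' : submodule F) : rat :=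
  \sum_(x : X l | sub_le w (val x) && sub_le (val x) f') m x w.
have Cinv (g : automorphism F) w f' :
    C (preim_submod g w) (preim_submod g f') = C w f'.
  rewrite /C (reindex (@aut_inv _ _ g l)) /=; last exact/onW_bij/aut_inv_bij.
  by apply: eq_big => x; rewrite ?minv // !sub_le_preim.
have Cflag (w w' f f' : submodule F) :
    has_type phi f -> has_type phi f' -> lmod_iso w w' ->
    sub_le w f -> sub_le w' f' -> C w f = C w' f'.
  move=> phif phif' ww' /sub_leP wf /sub_leP wf'.
  have wt := submod_typeP finF w.
  have [g [<- <-]] := flag_orbit couple typeF phif phif' wf wf' wt
    (has_type_iso wt ww').
  exact: Cinv.
have /choice[a aP] : forall r : submodule F, exists q,
    forall w f' : submodule F, lmod_iso r w ->
    has_type phi f' -> sub_le w f' -> C w f' = q.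
  move=> r; have [[w [f [rw phif wf]]]|N] := pselect (exists w f : submodule F,
    [/\ lmod_iso r w, has_type phi f & sub_le w f]).
    exists (C w f) => w' f' rw' phif' wf'; apply: Cflag => //.
    exact: lmod_iso_trans (lmod_iso_sym rw') rw.
  by exists 0 => w f ? ? ?; case: N; exists w, f.
exists (fun w => a (iso_rep w)); split=> [x y xy|u f].
  by rewrite (iso_rep_eq xy).
rewrite delta_expansion.
under eq_bigr => x _.
  rewrite T_precE -/(M f x) -M'E mE mulr_suml; over.
rewrite (exchange_big_dep xpredT) //=; apply: eq_bigr => f' _.
rewrite -mulr_sumr; congr (_ * _).
rewrite (exchange_big_dep (fun w => [&& sub_le w (val f), sub_le w (val f') &
  `[< exists2 m, has_type m w & mtype_le m l >]])) /=; last first.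
  move=> x w xf'; rewrite sub_le_cap => /andP[wx ->].
  rewrite (sub_le_trans wx xf') /=; apply/asboolP; exists (submod_type finF w).
    exact: submod_typeP.
  exact: has_type_le (submod_typeP finF w) (has_type_submods x) wx.
apply: eq_bigr => w /and3P[wf wf' _].
rewrite -(aP _ _ _ (lmod_iso_sym (iso_repP w)) (has_type_submods f') wf').
by apply: eq_bigl => x; rewrite sub_le_cap wf andbT andbC.
Qed.

End HeckeAlgebra.

(** * The Hecke algebra: basis, ideals, commutativity *)

Section TypeIndices.
Variables (R : pzRingType) (F : lmodType R) (Phi phi : mtype R).
Hypotheses (couple : symmetric_couple Phi phi) (typeF : has_type Phi F).
Hypothesis finF : finite_set [set: submodule F]%classic.

Local Notation X l := (submods F l).
Local Notation E := (all_submods F).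
Local Notation A := (hecke F phi).

(** A type is a predicate on all modules, so it lives in a larger universe than
    [F]; the finitely many types below [phi] are therefore indexed by canonical
    representatives among the submodules of [F]. *)
Definition type_reps : {fset submodule F} :=
  fset_set [set x : submodule F | iso_rep x = x /\
                                  mtype_le (submod_type finF x) phi]%classic.

Local Notation I := type_reps.

(** The type, the comparison of types and the operator [c] attached to
    representatives. *)
Definition rep_type (i : I) : mtype R := submod_type finF (val i).
Definition rep_le : rel I :=
  fun i j => `[< mtype_le (rep_type i) (rep_type j) >].
Definition rep_c (i : I) : A := hecke_c F phi (rep_type i).

Lemma mem_type_reps x : x \in type_reps ->
  iso_rep x = x /\ mtype_le (submod_type finF x) phi.
Proof. by rewrite in_fset_set ?inE //; apply: sub_finite_set finF. Qed.

Lemma rep_type_le i : mtype_le (rep_type i) phi.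
Proof. by have [] := mem_type_reps (valP i). Qed.

Lemma rep_typeP (i : I) : has_type (rep_type i) (val i).
Proof. exact: submod_typeP. Qed.

Lemma rep_type_inj : injective rep_type.
Proof.
move=> i j ij; apply: val_inj.
have [<- _] := mem_type_reps (valP i); have [<- _] := mem_type_reps (valP j).
apply: iso_rep_eq; apply: iso_has_type (rep_typeP i) _; rewrite ij.
exact: rep_typeP.
Qed.

Lemma rep_type_surj l : mtype_le l phi -> exists i, rep_type i = l.
Proof.
move=> lphi; have [x lx] := mtype_le_Phi couple typeF lphi.
have lr : has_type l (iso_rep x) := has_type_iso lx (iso_repP x).
have rI : iso_rep x \in type_reps.
  rewrite in_fset_set; last exact: sub_finite_set finF.
  rewrite inE; split; first exact/esym/iso_rep_eq/iso_repP.
  by have /submod_typeE -> := lr.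
by exists [` rI]%fset; apply/submod_typeE.
Qed.

Lemma rep_le_refl : reflexive rep_le.
Proof. by move=> i; apply/asboolP/mtype_le_refl. Qed.

Lemma rep_le_trans : transitive rep_le.
Proof.
by move=> j i k /asboolP ij /asboolP jk; apply/asboolP/(mtype_le_trans ij jk).
Qed.

Lemma rep_le_anti : antisymmetric rep_le.
Proof.
move=> i j /andP[/asboolP ij /asboolP ji]; apply: rep_type_inj.
exact: (mtype_le_anti couple typeF finF (rep_type_le i)).
Qed.

(** The span of the [c_m] with [m <= l] is a left ideal. *)
Lemma hecke_mul_c_span (h : A) l : mtype_le l phi ->
  exists a : I -> rat,
    h * hecke_c F phi l =
      \sum_(i | `[< mtype_le (rep_type i) l >]) a i *: rep_c i.
Proof.
move=> lphi.
pose B : 'Hom(submod_fun F l, submod_fun F phi) := (val h \o T_succ F phi l)%VF.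
have Bequiv g u : B (aut_act g u) = aut_act g (B u).
  by rewrite !comp_lfunE T_succ_equivariant; have /equivariantP-> := valP h.
have [a [aiso aE]] := equivariant_factor couple typeF finF lphi Bequiv.
exists (fun i => a (val i)); apply: kernel_inj => f f'.
rewrite {1}/kernel /= comp_lfunA comp_lfunE aE sum_delta.
rewrite kernel_sum (eq_bigr _ (fun i _ => congr1 _ (kernel_c finF _ f f'))).
rewrite (eq_bigr _ (fun i _ => num_commonE _ _ _ _)).
rewrite (exchange_big_dep (fun w => [&& sub_le w (val f), sub_le w (val f') &
  `[< exists2 m, has_type m w & mtype_le m l >]])) /=; last first.
  move=> i w /asboolP il /and3P[/asboolP iw -> ->] /=.
  by apply/asboolP; exists (rep_type i).
apply: eq_bigr => w /and3P[wf wf' /asboolP[m mw ml]].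
have [i im] := rep_type_surj (mtype_le_trans ml lphi).
rewrite (big_pred1 i) => [|j /=].
  by apply: aiso; apply: iso_has_type mw _; rewrite -im; apply: rep_typeP.
rewrite wf wf'; apply/andP/eqP => [[_ /andP[/asboolP jw _]]|->].
  by apply: rep_type_inj; rewrite im; apply: (has_type_inj (M := w)) mw.
split; first by apply/asboolP; rewrite im.
by rewrite !andbT; apply/asboolP; rewrite -im in mw.
Qed.

Lemma hecke_c_phi : hecke_c F phi phi = 1.
Proof.
have sub_eq (f f' : X phi) : sub_le (val f) (val f') = (f == f').
  apply/idP/eqP => [ff'|->]; last exact: sub_le_refl.
  by apply/val_inj/(sub_same_type couple typeF finF _ _ ff');
    apply: has_type_submods.
apply: val_inj; apply/lfunP => u; apply/ffunP => f.
rewrite /= comp_lfunE id_lfunE T_succE.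
rewrite (big_pred1 f) => [|x /=]; last exact: sub_eq.
by rewrite T_precE (big_pred1 f) => [//|x /=]; rewrite sub_eq eq_sym.
Qed.

Lemma rep_c_span (h : A) : exists a : I -> rat, h = \sum_i a i *: rep_c i.
Proof.
have [a ha] := hecke_mul_c_span h (mtype_le_refl phi).
exists a; rewrite -[LHS]mulr1 -hecke_c_phi ha; apply: eq_bigl => i.
by apply/asboolP/rep_type_le.
Qed.

(** Independence: evaluated at [f], [f'] with [cap f f'] of type [i], the
    kernels of the [rep_c j] vanish unless [j <= i], and that of [rep_c i] is
    positive. *)
Lemma rep_c_free (a : I -> rat) :
  \sum_i a i *: rep_c i = 0 -> forall i, a i = 0.
Proof.
move=> a0 i; have [n] := ubnP #|[set j | rep_le j i]|.
elim: n i => // n IHn i len.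
have [_ _ phiPhi coupleF] := couple.
have [f phif] := mtype_le_Phi couple typeF (mtype_le_refl phi).
have [[f' phif' iff'] _] := coupleF F f _ typeF phif (rep_type_le i).
have memX (y : submodule F) : has_type phi y -> y \in X phi.
  by rewrite mem_submods // => /asboolP.
pose xf : X phi := [` memX f phif]%fset.
pose xf' : X phi := [` memX f' phif']%fset.
have : kernel (\sum_j a j *: rep_c j) xf xf' = 0.
  by rewrite a0 /kernel zero_lfunE ffunE.
rewrite kernel_sum (bigD1 i) //= big1 => [|j jNi].
  rewrite addr0 kernel_c // => /eqP; rewrite mulf_eq0 => /orP[/eqP//|].
  by rewrite pnatr_eq0 -leqn0 leqNgt num_common_gt0.
have [ji|Nji] := boolP (rep_le j i).
  rewrite IHn ?mul0r //; apply: (@leq_trans #|[set k | rep_le k i]|) => //.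
  apply/proper_card/properP; split.
    by apply/fintype.subsetP => k; rewrite !inE => kj; apply: rep_le_trans ji.
  exists i; rewrite !inE ?rep_le_refl //; apply: contra jNi => ij.
  by apply/eqP/rep_le_anti; rewrite ji.
rewrite kernel_c // (_ : num_common _ _ _ = 0%N) ?mulr0 //.
apply/eqP; rewrite -leqn0 leqNgt -has_count; apply: contra Nji => /hasP[w _].
rewrite -sub_le_cap => /andP[/asboolP jw wff']; apply/asboolP.
exact: has_type_le jw iff' wff'.
Qed.

(** Every kernel is symmetric, being a combination of those of the [rep_c i]. *)
Lemma kernel_sym (h : A) f f' : kernel h f f' = kernel h f' f.
Proof.
have [a ->] := rep_c_span h; rewrite !kernel_sum; apply: eq_bigr => i _.
by rewrite !kernel_c // num_commonC.
Qed.

Lemma hecke_mulC : commutative (@GRing.mul A).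
Proof.
move=> h k; apply: kernel_inj => f f'; rewrite kernel_sym !kernelM.
by apply: eq_bigr => f'' _; rewrite mulrC (kernel_sym h f') (kernel_sym k f'').
Qed.

(** A diagonal entry of [h * h] is a sum of squares of entries of [h]. *)
Lemma hecke_reduced (h : A) : h * h = 0 -> h = 0.
Proof.
move=> hh0; apply: kernel_inj => f f'.
have kernel0 f1 f2 : kernel (0 : A) f1 f2 = 0.
  by rewrite -[0 in LHS](scale0r (0 : A)) kernelZ mul0r.
have /eqP : kernel (h * h) f f = 0 by rewrite hh0 kernel0.
rewrite kernelM psumr_eq0 => [|f'' _]; last first.
  by rewrite kernel_sym -expr2 sqr_ge0.
move/allP/(_ f' (mem_index_enum _)).
rewrite /= kernel_sym -expr2 sqrf_eq0 => /eqP->.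
by rewrite kernel0.
Qed.

End TypeIndices.

(** * Reduced commutative algebras with a triangular basis *)

Section TriangularAlgebra.
Variables (A : comPzRingType) (iota : {rmorphism rat -> A}).
Variables (I : finType) (le : rel I) (c : I -> A).

(** The span of the [c i] with [i] in [D]; [iota] is the structure map of
    the rational algebra [A]. *)
Definition spanned (D : {set I}) (a : A) : Prop :=
  exists2 q : I -> rat, (forall i, i \notin D -> q i = 0) &
    a = \sum_i iota (q i) * c i.

(** Closed under passing to smaller indices. *)
Definition downset (D : {set I}) : Prop :=
  forall i j, i \in D -> le j i -> j \in D.

(** The down-set of the indices smaller than or equal to [i]. *)
Definition below (i : I) : {set I} := [set j | le j i].

Lemma spanned0 D : spanned D 0.
Proof.
by exists (fun=> 0) => //; rewrite big1 // => i _; rewrite rmorph0 mul0r.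
Qed.

Lemma spannedD D a b : spanned D a -> spanned D b -> spanned D (a + b).
Proof.
move=> [q q0 ->] [r r0 ->]; exists (fun i => q i + r i).
  by move=> i iD; rewrite q0 ?r0 ?addr0.
by rewrite -big_split; apply: eq_bigr => i _; rewrite rmorphD mulrDl.
Qed.

Lemma spannedZ D s a : spanned D a -> spanned D (iota s * a).
Proof.
move=> [q q0 ->]; exists (fun i => s * q i) => [i iD|].
  by rewrite q0 ?mulr0.
by rewrite mulr_sumr; apply: eq_bigr => i _; rewrite rmorphM mulrA.
Qed.

Lemma spannedN D a : spanned D a -> spanned D (- a).
Proof. by move/(spannedZ (-1)); rewrite rmorphN1 mulN1r. Qed.

Lemma spannedB D a b : spanned D a -> spanned D b -> spanned D (a - b).
Proof. by move=> aD bD; apply/spannedD/spannedN. Qed.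

Lemma spanned_sum D (P : pred I) (f : I -> A) :
  (forall i, P i -> spanned D (f i)) -> spanned D (\sum_(i | P i) f i).
Proof.
by move=> fD; elim/big_ind: _ => //; [apply: spanned0|apply: spannedD].
Qed.

Lemma spannedS (D D' : {set I}) a : D \subset D' -> spanned D a -> spanned D' a.
Proof.
move=> sDD' [q q0 ->]; exists q => // i iD'.
by apply: q0; apply: contra iD' => /(fintype.subsetP sDD').
Qed.

Lemma spanned_gen (D : {set I}) i : i \in D -> spanned D (c i).
Proof.
move=> iD; exists (fun j => (j == i)%:R) => [j|].
  by case: eqP => // ->; rewrite iD.
rewrite (bigD1 i) //= eqxx rmorph1 mul1r big1 ?addr0 // => j /negPf->.
by rewrite rmorph0 mul0r.
Qed.

Hypotheses (le_refl : reflexive le) (le_anti : antisymmetric le)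
  (le_trans : transitive le).
Hypothesis c_free :
  forall q : I -> rat, \sum_i iota (q i) * c i = 0 -> forall i, q i = 0.
Hypothesis c_ideal : forall a i, spanned (below i) (a * c i).
Hypothesis reduced : forall a : A, a * a = 0 -> a = 0.

Lemma below_down i : downset (below i).
Proof. by move=> j k; rewrite !inE => ji kj; apply: le_trans ji. Qed.

Lemma below1_down i : downset (below i :\ i).
Proof.
move=> j k; rewrite !inE => /andP[jNi ji] kj; rewrite (le_trans kj ji) andbT.
apply: contraNneq jNi => ki; apply/eqP/le_anti.
by rewrite ji -ki.
Qed.

Lemma spanned_uniq (q r : I -> rat) :
  \sum_i iota (q i) * c i = \sum_i iota (r i) * c i -> q =1 r.
Proof.
move=> /eqP; rewrite -subr_eq0 -sumrB => /eqP qr i; apply/eqP.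
rewrite -subr_eq0; apply/eqP; apply: (c_free (q := fun i => q i - r i)).
by rewrite -[RHS]qr; apply: eq_bigr => j _; rewrite rmorphB mulrBl.
Qed.

Lemma spannedI D D' a : spanned D a -> spanned D' a -> spanned (D :&: D') a.
Proof.
move=> [q q0 ->] [r r0] /spanned_uniq qr; exists q => // i.
by rewrite inE negb_and => /orP[/q0//|]; rewrite qr => /r0.
Qed.

Lemma spanned_gen_inv (D : {set I}) i : spanned D (c i) -> i \in D.
Proof.
case: (boolP (i \in D)) => // iD cD.
have [q q0 ci0] := spannedI cD (spanned_gen (set11 i)).
have [r _ ci] := spanned_gen (set11 i).
have /spanned_uniq/(_ i) : \sum_j iota ((j == i)%:R) * c j =
    \sum_j iota (q j) * c j.
  rewrite -ci0 (bigD1 i) //= eqxx rmorph1 mul1r big1 ?addr0 // => j /negPf->.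
  by rewrite rmorph0 mul0r.
by rewrite eqxx q0 ?inE ?(negPf iD) // => /eqP; rewrite oner_eq0.
Qed.

Lemma spanned_mul D a b : downset D -> spanned D b -> spanned D (a * b).
Proof.
move=> downD [q q0 ->]; rewrite mulr_sumr.
apply: spanned_sum => i _; have [iD|/q0->] := boolP (i \in D); last first.
  by rewrite rmorph0 mul0r mulr0; apply: spanned0.
rewrite mulrCA; apply/spannedZ/(spannedS _ (c_ideal a i)).
by apply/fintype.subsetP => j; rewrite inE; apply: downD.
Qed.

Lemma spanned_split (D : {set I}) i a : i \in D -> spanned D a ->
  exists q a', a = iota q * c i + a' /\ spanned (D :\ i) a'.
Proof.
move=> iD [q q0 ->]; exists (q i), (\sum_(j | j != i) iota (q j) * c j).
rewrite (bigD1 i) //=; split=> //; apply: spanned_sum => j jNi.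
have [jD|/q0->] := boolP (j \in D); last first.
  by rewrite rmorph0 mul0r; apply: spanned0.
by apply/spannedZ/spanned_gen; rewrite !inE jNi.
Qed.

(** The ideal of a down-set has an identity: adding a maximal index [i] to a
    down-set [D'] with identity [e], the element [(1 - e) * c i] is an
    eigenvector of every element of [A], and its eigenvalue under itself is
    nonzero because [A] is reduced, so that it can be rescaled to an
    idempotent. *)
Lemma ideal_id (D : {set I}) : downset D ->
  exists2 e, spanned D e & forall a, spanned D a -> e * a = a.
Proof.
have [n] := ubnP #|D|; elim: n D => // n IHn D leDn downD.
have [->|[i0 i0D]] := set_0Vmem D.
  exists 0 => [|a [q q0 ->]]; first exact: spanned0.
  by rewrite mul0r big1 // => i _; rewrite q0 ?inE // rmorph0 mul0r.
have [i iD maxi] := arg_maxnP (fun i => #|below i|) i0D.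
have {}iD : i \in D := iD.
have downD' : downset (D :\ i).
  move=> j k; rewrite !inE => /andP[jNi jD] kj; rewrite (downD _ _ jD kj) andbT.
  apply: contra jNi => /eqP ki; move: kj; rewrite {}ki => ij {k}.
  apply/eqP/le_anti; rewrite ij andbT; apply: contraTT (maxi j jD) => Nji.
  rewrite -ltnNge; apply/proper_card/properP; split.
    by apply/fintype.subsetP => k; rewrite !inE => /le_trans; apply.
  by exists j; rewrite inE.
have [|e eD' e1] := IHn _ _ downD'.
  by move: leDn; rewrite (cardsD1 i D) iD add1n ltnS.
have {}eD: spanned D e by apply: spannedS eD'; apply: subsetDl.
pose b := (1 - e) * c i.
have killD a : spanned D a -> exists q, (1 - e) * a = iota q * b.
  case/(spanned_split iD) => q [a' [-> aD']]; exists q.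
  by rewrite mulrDr [_ * a']mulrBl mul1r e1 // subrr addr0 mulrCA.
have ee : (1 - e) * (1 - e) = 1 - e.
  by rewrite mulrBr mulr1 mulrBl mul1r e1 // subrr subr0.
have bD : spanned D b.
  by apply: spanned_mul => //; apply: spanned_gen.
have bb : b * b = c i * b.
  by rewrite {1}/b mulrAC {2}/b mulrA ee mulrC.
have [q bq] : exists q, b * b = iota q * b.
  rewrite {1}/b -mulrA; apply: killD; apply: spanned_mul => //.
have qN0 : q != 0.
  apply/eqP => q0; move: bq; rewrite q0 rmorph0 mul0r => /reduced /eqP.
  rewrite /b mulrBl mul1r subr_eq0 => /eqP ci.
  suff /spanned_gen_inv : spanned (D :\ i) (c i) by rewrite !inE eqxx.
  by rewrite ci mulrC; apply: spanned_mul.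
exists (e + iota q^-1 * b) => [|a aD].
  by apply: spannedD => //; apply: spannedZ.
have [r ar] := killD _ aD.
have ba : b * a = iota r * (iota q * b).
  by rewrite /b mulrAC ar -mulrA [b * _]mulrC -bb bq.
rewrite mulrDl -mulrA ba [iota r * _]mulrCA [iota q^-1 * _]mulrA.
rewrite -(rmorphM iota) mulVf //.
by rewrite rmorph1 mul1r -ar mulrBl mul1r addrC subrK.
Qed.

Hypothesis c_span : forall a, spanned [set: I] a.

(** The conclusion is the decomposition of [A] into one-dimensional blocks:
    [e i] is the identity of the ideal below [i] minus the identity of the
    ideal strictly below [i]. *)
Theorem triangular_idempotents :
  exists (e : I -> A) (chi : I -> A -> rat),
    [/\ forall i j, e i * e j = if i == j then e i else 0,
        forall i, e i != 0,
        \sum_i e i = 1,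
        forall i a, a * e i = iota (chi i a) * e i &
        forall D, downset D ->
          forall a, spanned D a <-> forall i, i \notin D -> a * e i = 0].
Proof.
have /choice[u uP] : forall i, exists u, spanned (below i) u /\
    forall a, spanned (below i) a -> u * a = a.
  by move=> i; have [u] := ideal_id (@below_down i); exists u.
have /choice[v vP] : forall i, exists v, spanned (below i :\ i) v /\
    forall a, spanned (below i :\ i) a -> v * a = a.
  by move=> i; have [v] := ideal_id (@below1_down i); exists v.
have subi i : below i :\ i \subset below i by apply: subsetDl.
have ini i : i \in below i by rewrite inE.
pose e i := u i - v i.
have eD i : spanned (below i) (e i).
  by apply: spannedB; [case: (uP i)|apply: spannedS (vP i).1].
have kill i a : spanned (below i :\ i) a -> e i * a = 0.
  move=> aD; rewrite mulrBl (vP i).2 // (uP i).2 ?subrr //.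
  exact: spannedS aD.
have killD D i a : downset D -> spanned D a -> i \notin D -> a * e i = 0.
  move=> downD aD iD.
  (* [a * e i] lies in the ideal of [D] and in that of [below i], hence
     strictly below [i], where [e i] acts as [0]. *)
  have aeD : spanned (below i :\ i) (a * e i).
    have : spanned (D :&: below i) (a * e i).
      apply: spannedI; first by rewrite mulrC; apply: spanned_mul.
      by apply: spanned_mul => //; apply: below_down.
    apply: spannedS; apply/fintype.subsetP => j; rewrite !inE => /andP[jD ->].
    by rewrite andbT; apply: contraNneq iD => <-.
  rewrite -((vP i).2 _ aeD) mulrCA [v i * _]mulrC kill ?mulr0 //.
  by case: (vP i).
have ee i : e i * e i = e i.
  rewrite {2}/e mulrBr (kill i (v i)) ?subr0; last by case: (vP i).
  by rewrite mulrC (uP i).2.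
have eN0 i : e i != 0.
  apply/eqP => /eqP; rewrite subr_eq0 => /eqP uv.
  suff /spanned_gen_inv : spanned (below i :\ i) (c i) by rewrite !inE eqxx.
  rewrite -((uP i).2 (c i)); last exact: spanned_gen.
  by rewrite uv mulrC; apply: spanned_mul; [apply: below1_down|case: (vP i)].
have eig i a : spanned (below i) a -> exists q, a * e i = iota q * (c i * e i).
  case/(spanned_split (ini i)) => q [a' [-> aD']]; exists q.
  by rewrite mulrDl [a' * _]mulrC kill // addr0 mulrA.
have /choice[chi chiP] : forall i, exists chi : A -> rat,
    forall a, a * e i = iota (chi a) * e i.
  move=> i; suff /choice[chi] : forall a, exists q, a * e i = iota q * e i.
    by exists chi.
  move=> a.
  have [q0 e0] := eig i _ (eD i); rewrite ee in e0.
  have q0N : q0 != 0.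
    by apply: contraTneq (eN0 i) => q00; rewrite e0 q00 rmorph0 mul0r eqxx.
  have [q aq] := eig i (a * e i) (spanned_mul a (@below_down i) (eD i)).
  exists (q / q0); rewrite -[in LHS]ee mulrA aq [in RHS]e0 [RHS]mulrA.
  by rewrite -(rmorphM iota) divfK.
have sum1 : \sum_i e i = 1.
  (* An element that kills every [e i] kills every [c i], by induction along
     the order, since [e i + v i] is an identity for [c i]. *)
  have killc a : (forall i, a * e i = 0) -> forall i, a * c i = 0.
    move=> ae i; have [n] := ubnP #|below i|.
    elim: n i => // n IHn i len.
    have ci : c i = (e i + v i) * c i.
      by rewrite subrK (uP i).2 //; apply: spanned_gen.
    rewrite ci mulrDl mulrDr mulrA ae mul0r add0r.
    have [q q0 ->] : spanned (below i :\ i) (v i * c i).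
      by rewrite mulrC; apply: spanned_mul; [apply: below1_down|case: (vP i)].
    rewrite mulr_sumr big1 // => j _; rewrite mulrCA.
    have [jD|/q0->] := boolP (j \in below i :\ i); last first.
      by rewrite rmorph0 mul0r.
    rewrite IHn ?mulr0 //; apply: (@leq_trans #|below i|) => //.
    apply/proper_card/properP.
    move: jD; rewrite !inE => /andP[jNi ji]; split.
      by apply/fintype.subsetP => k; rewrite !inE => /le_trans; apply.
    exists i => //; rewrite inE; apply: contra jNi => ij.
    by apply/eqP/le_anti; rewrite ji.
  apply/eqP; rewrite eq_sym -subr_eq0; set r := _ - _.
  have [q _ r1] := c_span 1; rewrite -[r]mulr1 r1 mulr_sumr big1 // => i _.
  rewrite mulrCA killc ?mulr0 // => j; rewrite mulrBl mul1r mulr_suml.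
  rewrite (bigD1 j) //= ee big1 ?addr0 ?subrr // => k kNj.
  have [jk|Njk] := boolP (le j k).
    rewrite mulrC (killD (below j)) ?inE //; first exact: below_down.
    by apply: contra kNj => kj; apply/eqP/le_anti; rewrite kj.
  by rewrite (killD (below k)) ?inE //; apply: below_down.
exists e, chi; split=> // [i j|D downD a].
  case: eqP => [<-//|/eqP iNj].
  have [ji|Nji] := boolP (le j i); last first.
    by rewrite (killD (below i)) ?inE //; apply: below_down.
  rewrite mulrC (killD (below j)) ?inE //; first exact: below_down.
  by apply: contra iNj => ij; apply/eqP/le_anti; rewrite ij.
split=> [aD i iD|ae]; first exact: killD aD iD.
rewrite -[a]mulr1 -sum1 mulr_sumr; apply: spanned_sum => i _.
have [iD|/ae->] := boolP (i \in D); last exact: spanned0.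
apply: spanned_mul => //; apply: spannedS (eD i).
by apply/fintype.subsetP => j; rewrite inE; apply: downD.
Qed.

End TriangularAlgebra.

(** * One-dimensional modules over an algebra split into blocks *)

Section CharacterLines.
Variables (A : pzRingType) (iota : {rmorphism rat -> A}).
Hypothesis iota_central : forall a q, a * iota q = iota q * a.

(** A one-dimensional rational space on which [A] acts through [chi]. *)
Definition char_line (V : lmodType A) (chi : A -> rat) : Prop :=
  exists2 v : V, v != 0 &
    (forall a, a *: v = iota (chi a) *: v) /\
    (forall w, exists q, w = iota q *: v).

Lemma iota_scale_inj (V : lmodType A) (v : V) q r :
  v != 0 -> iota q *: v = iota r *: v -> q = r.
Proof.
move=> vN0 /eqP; rewrite -subr_eq0 -scalerBl -rmorphB => /eqP qv.
apply/eqP; rewrite -subr_eq0; apply: contraNT vN0 => qrN0.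
rewrite -[v]scale1r -(rmorph1 iota) -(mulVf qrN0) rmorphM -scalerA qv.
by rewrite scaler0.
Qed.

Lemma char_line_irreducible V chi : char_line V chi -> irreducible V.
Proof.
move=> [v vN0 [av vgen]]; split; first by exists v.
move=> S; have [[w [wS wN0]]|S0] := pselect (exists w, w \in S /\ w != 0).
  have [q wq] := vgen w.
  have qN0 : q != 0.
    by apply: contraNneq wN0 => q0; rewrite wq q0 rmorph0 scale0r.
  have vS : v \in S.
    have -> : v = iota q^-1 *: w.
      by rewrite wq scalerA -rmorphM mulVf // rmorph1 scale1r.
    exact: rpredZ.
  by right=> u; have [r ->] := vgen u; apply: rpredZ.
left=> w wS; apply/eqP; apply/negP => /negP wN0; apply: S0.
by exists w.
Qed.

Lemma char_line_iso V W chi :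
  char_line V chi -> char_line W chi -> lmod_iso V W.
Proof.
move=> [v vN0 [av /choice[q vq]]] [w wN0 [aw wgen]].
have qZ r : q (iota r *: v) = r by apply: (iota_scale_inj vN0); rewrite -vq.
apply: (@lmod_iso_of_bij A V W (fun u => iota (q u) *: w)).
- move=> a x y; have -> : q (a *: x + y) = q x * chi a + q y.
    rewrite -[RHS]qZ rmorphD rmorphM scalerDl -scalerA -av scalerA.
    by rewrite -iota_central -scalerA -!vq.
  rewrite rmorphD rmorphM scalerDl -scalerA -aw scalerA.
  by rewrite -iota_central -scalerA.
- by move=> x y /(iota_scale_inj wN0) qxy; rewrite (vq x) (vq y) qxy.
by move=> u; have [r ->] := wgen u; exists (iota r *: v); rewrite qZ.
Qed.

Lemma char_line_uniq V W chi chi' :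
  char_line V chi -> char_line W chi' -> lmod_iso V W -> chi =1 chi'.
Proof.
move=> [v vN0 [av _]] [w wN0 [aw wgen]] [f fbij] a.
have fvN0 : f v != 0.
  apply: contraNneq vN0 => fv0; apply/eqP/(bij_inj fbij).
  by rewrite fv0 linear0.
apply: (iota_scale_inj fvN0); rewrite -linearZ_LR -av linearZ_LR.
have [q ->] := wgen (f v).
by rewrite scalerA iota_central -scalerA aw !scalerA -iota_central.
Qed.

Section Blocks.
Variables (I : finType) (e : I -> A) (chi : I -> A -> rat).
Hypothesis e_orth : forall i j, e i * e j = if i == j then e i else 0.
Hypothesis e_neq0 : forall i, e i != 0.
Hypothesis e_sum : \sum_i e i = 1.
Hypothesis e_chi : forall i a, a * e i = iota (chi i a) * e i.

Lemma chi_idem i j : chi i (e j) = (i == j)%:R.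
Proof.
apply: (@iota_scale_inj A^o (e i)); first exact: e_neq0.
rewrite /GRing.scale /= -e_chi e_orth eq_sym; case: eqP => [->|_].
  by rewrite rmorph1 mul1r.
by rewrite rmorph0 mul0r.
Qed.

Lemma chi_inj i j : chi i =1 chi j -> i = j.
Proof.
by move=> /(_ (e i)); rewrite !chi_idem eqxx; case: eqP => // _ /eqP.
Qed.

(** Some block [e i] does not kill a given nonzero vector [w], and the line
    spanned by [e i *: w] is a submodule. *)
Lemma irreducible_char_line (W : lmodType A) :
  irreducible W -> exists i, char_line W (chi i).
Proof.
move=> [[w wN0] irrW].
have [i eiwN0] : exists i, e i *: w != 0.
  apply/existsP; apply: contraNT wN0; rewrite negb_exists => /forallP ew.
  rewrite -[w]scale1r -e_sum scaler_suml big1 // => i _.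
  by apply/eqP; rewrite -[_ == _]negbK; apply: ew.
pose v := e i *: w; exists i, v => //.
have av a : a *: v = iota (chi i a) *: v by rewrite /v !scalerA e_chi.
split=> //.
have lineP : submod_closed [pred u : W | `[< exists q, u = iota q *: v >]].
  split=> [|a x y]; rewrite !inE; first by exists 0; rewrite rmorph0 scale0r.
  move=> [q ->] [r ->]; exists (q * chi i a + r).
  rewrite scalerA iota_central -scalerA av scalerA -scalerDl.
  by rewrite -rmorphM -rmorphD.
have [S0|ST u] := irrW (Submodule lineP).
  have /S0 v0 : v \in Submodule lineP.
    by rewrite inE; exists 1; rewrite rmorph1 scale1r.
  by move: eiwN0; rewrite -/v v0 eqxx.
by move: (ST u); rewrite inE.
Qed.

(** A left ideal cut out by the vanishing of all blocks outside the image of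
    [mu] is a sum of lines: the isomorphism sends [h] to the family [h *: v k],
    for generators [v k] of the lines. *)
Lemma block_sum_iso (T : submodule A^o) n (mu : 'I_n -> I)
    (V : 'I_n -> lmodType A) :
  injective mu ->
  (forall h : A, h \in T <-> forall i, (forall k, mu k != i) -> h * e i = 0) ->
  (forall k, char_line (V k) (chi (mu k))) ->
  lmod_iso T (direct_sum V).
Proof.
move=> muI TP Vchi.
have v k : {v : V k | v != 0 /\
    (forall a, a *: v = iota (chi (mu k) a) *: v) /\
    (forall w, exists q, w = iota q *: v)}.
  by apply: cid; have [v vN0 vP] := Vchi k; exists v.
apply: (@lmod_iso_of_bij A T (direct_sum V)
  (fun (h : T) k => (val h : A) *: sval (v k))).
- move=> a x y; apply: functional_extensionality_dep => k /=.
  by rewrite -[LHS]/((a * val x + val y) *: sval (v k)) scalerDl -scalerA.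
- move=> x y xy; apply: val_inj; apply/eqP; rewrite -subr_eq0.
  have xyT : (val x - val y : A) \in T by apply: rpredB; apply: valP.
  rewrite -[_ - _](mulr1 (_ : A)) -e_sum mulr_sumr big1 // => i _.
  have [k /eqP ki|Nki] := pickP (fun k => mu k == i); last first.
    by move/TP: xyT; apply=> k; rewrite Nki.
  have [vkN0 [vk _]] := svalP (v k).
  rewrite e_chi -ki; suff -> : chi (mu k) (val x - val y) = 0.
    by rewrite rmorph0 mul0r.
  apply: (iota_scale_inj vkN0).
  rewrite -vk scalerBl rmorph0 scale0r; apply/eqP; rewrite subr_eq0; apply/eqP.
  exact: (congr1 (fun f : direct_sum V => f k) xy).
move=> u.
have q k : {q : rat | u k = iota q *: sval (v k)}.
  by apply: cid; have [_ [_]] := svalP (v k); apply.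
pose h : A := \sum_k iota (sval (q k)) * e (mu k).
have hT : h \in T.
  apply/TP => i Nki; rewrite mulr_suml big1 // => k _.
  by rewrite -mulrA e_orth (negPf (Nki k)) mulr0.
exists (Sub h hT : submod_of T); apply: functional_extensionality_dep => k /=.
have [vkN0 [vk _]] := svalP (v k).
rewrite scaler_suml (bigD1 k) //= -scalerA vk chi_idem eqxx rmorph1 scale1r.
rewrite -(svalP (q k)) big1 ?addr0 // => l lNk.
rewrite -scalerA vk chi_idem eq_sym (inj_eq muI) (negPf lNk) rmorph0.
by rewrite scale0r scaler0.
Qed.

Lemma subquotient_char_line (T S : submodule A^o) i :
  (e i : A) \in T -> (e i : A) \notin S ->
  (forall t : A, t \in T -> t - t * e i \in S) ->
  char_line (subquotient T S) (chi i).
Proof.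
move=> eT eS tS.
pose et : submod_lmod T := Sub (e i) eT : submod_of T.
pose pi (t : submod_lmod T) : subquotient T S := quot_pi _ t.
have piZ a t : a *: pi t = pi (a *: t) by apply: quot_scale_pi.
exists (pi et).
  apply: contra eS => /eqP pi0.
  have /quot_pi_eq : pi et = pi (0 *: et) by rewrite pi0 -piZ scale0r.
  by rewrite scale0r subr0.
have eig a : a *: et = iota (chi i a) *: et.
  by apply: val_inj; apply: e_chi.
split=> [a|w]; first by rewrite !piZ eig.
exists (chi i (val (quot_repr w))); rewrite piZ -eig -[LHS]quot_reprK.
apply/quot_pi_eq; rewrite inE raddfB.
by apply: tS; apply: valP.
Qed.

End Blocks.
End CharacterLines.

(** * The blocks of the Hecke algebra *)

Section RationalScalars.
Variables (R : pzRingType) (F : lmodType R) (phi : mtype R).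

(** The embedding of the rationals as scalars of the Hecke algebra. *)
Definition hecke_scalar (q : rat) : hecke F phi := q *: (1 : hecke F phi).

Lemma hecke_scaleE q (h : hecke F phi) : q *: h = hecke_scalar q * h.
Proof.
by apply: val_inj; rewrite /= -comp_lfunZl comp_lfun1l.
Qed.

Fact hecke_scalar_zmod : zmod_morphism hecke_scalar.
Proof. by move=> q r; rewrite /hecke_scalar scalerBl. Qed.

Fact hecke_scalar_monoid : monoid_morphism hecke_scalar.
Proof.
split=> [|q r]; first exact: scale1r.
by rewrite -hecke_scaleE /hecke_scalar scalerA.
Qed.

HB.instance Definition _ :=
  GRing.isZmodMorphism.Build rat (hecke F phi) hecke_scalar hecke_scalar_zmod.
HB.instance Definition _ :=
  GRing.isMonoidMorphism.Build rat (hecke F phi) hecke_scalar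
    hecke_scalar_monoid.

End RationalScalars.

Section Structure.
Variables (R : pzRingType) (F : lmodType R) (Phi phi : mtype R).
Hypotheses (couple : symmetric_couple Phi phi) (typeF : has_type Phi F).
Hypothesis finF : finite_set [set: submodule F]%classic.

Local Notation A := (hecke F phi).
Local Notation iota := (hecke_scalar F phi).
Local Notation I := (type_reps phi finF).
Local Notation c := (@rep_c R F phi finF).
Local Notation le := (@rep_le R F phi finF).

(** The Hecke algebra as a commutative ring, and its rational scalars. *)
Definition hecke_com : comPzRingType := HB.pack_for comPzRingType A
  (GRing.PzRing_hasCommutativeMul.Build A (hecke_mulC couple typeF finF)).

Definition iota_com : {rmorphism rat -> hecke_com} := iota.

Local Notation spanned_c := (@spanned hecke_com iota_com I c).

Lemma spanned_of_sum (P : pred I) (a : I -> rat) :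
  spanned_c [set i | P i] (\sum_(i | P i) a i *: c i : A).
Proof.
exists (fun i => if P i then a i else 0) => [i|].
  by rewrite inE => /negPf->.
rewrite [LHS]big_mkcond; apply: eq_bigr => i _; case: (P i).
  exact: hecke_scaleE.
by rewrite rmorph0 mul0r.
Qed.

(** Membership in a rational span of operators [c_m], read on
    representatives. *)
Lemma span_spanned (P : mtype R -> Prop) (D : {set I}) (h : A) :
  (forall m, P m <-> exists2 i, i \in D & rep_type i = m) ->
  h \in Defs.span (fun h => exists2 m, P m & h = hecke_c F phi m) <->
    spanned_c D h.
Proof.
move=> PD; split=> [|[q q0 ->]].
  have spP : submod_closed [pred h : A | `[< spanned_c D h >]].
    split=> [|q x y]; rewrite !inE; first exact: spanned0.
    move=> xD yD; rewrite hecke_scaleE; apply: spannedD => //.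
    exact: (spannedZ q xD).
  rewrite inE => /(_ (Submodule spP)); rewrite inE.
  apply=> _ [m /PD[i iD <-] ->].
  by rewrite inE; apply: (@spanned_gen hecke_com iota_com I c D i iD).
rewrite inE => S Sc; apply: rpred_sum => i _.
have [iD|/q0->] := boolP (i \in D); last by rewrite rmorph0 mul0r rpred0.
rewrite -[_ * _]/(iota (q i) * c i) -hecke_scaleE; apply/rpredZ/Sc.
by exists (rep_type i) => //; apply/PD; exists i.
Qed.

Lemma mem_hecke_le i (h : A) :
  h \in hecke_le F phi (rep_type i) <-> spanned_c (below le i) h.
Proof.
apply: span_spanned => m; split=> [mi|[j]]; last first.
  by rewrite inE => /asboolP ji <-.
have [j jm] := rep_type_surj couple typeF finF
  (mtype_le_trans mi (rep_type_le i)).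
by exists j => //; rewrite inE; apply/asboolP; rewrite jm.
Qed.

Lemma mem_hecke_lt i (h : A) :
  h \in hecke_lt F phi (rep_type i) <-> spanned_c (below le i :\ i) h.
Proof.
apply: span_spanned => m; split=> [[mi mNi]|[j]].
  have [j jm] := rep_type_surj couple typeF finF
    (mtype_le_trans mi (rep_type_le i)).
  exists j => //; rewrite !inE; apply/andP; split; last first.
    by apply/asboolP; rewrite jm.
  by apply/eqP => ji; apply: mNi; rewrite -jm ji.
rewrite !inE => /andP[jNi /asboolP ji] <-; split=> // /rep_type_inj jE.
by rewrite jE eqxx in jNi.
Qed.

(** The Hecke algebra splits into one-dimensional blocks, and its two families
    of subspaces are annihilators of blocks. *)
Lemma hecke_blocks :
  exists (e : I -> A) (chi : I -> A -> rat),
    [/\ forall i j, e i * e j = if i == j then e i else 0,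
        forall i, e i != 0,
        \sum_i e i = 1,
        forall i a, a * e i = iota (chi i a) * e i &
        (forall i h, h \in hecke_le F phi (rep_type i) <->
           forall j, ~~ le j i -> h * e j = 0) /\
        (forall i h, h \in hecke_lt F phi (rep_type i) <->
           forall j, ~~ ((j != i) && le j i) -> h * e j = 0)].
Proof.
have cfree (q : I -> rat) :
    \sum_i iota_com (q i) * c i = 0 -> forall i, q i = 0.
  move=> q0; apply: (rep_c_free couple typeF (finF := finF) (a := q)).
  by rewrite -[RHS]q0; apply: eq_bigr => i _; apply: hecke_scaleE.
have cideal (a : hecke_com) i : spanned_c (below le i) (a * c i).
  have [b] := hecke_mul_c_span couple typeF finF a (rep_type_le i).
  rewrite -[a * c i]/((a : A) * rep_c i) => ->; exact: spanned_of_sum.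
have cspan (a : hecke_com) : spanned_c [set: I] a.
  have [b ->] := rep_c_span couple typeF finF a.
  by apply: spannedS (spanned_of_sum xpredT b); apply/fintype.subsetP.
have [e [chi [orth eN0 sum1 eig blocks]]] :=
  triangular_idempotents (@rep_le_refl _ _ _ finF)
    (rep_le_anti couple typeF (finF := finF)) (@rep_le_trans _ _ _ finF)
    cfree cideal (hecke_reduced couple typeF finF) cspan.
exists e, chi; split=> //; split=> i h.
  rewrite mem_hecke_le blocks; last exact/below_down/rep_le_trans.
  by split=> he j ji; apply: he; move: ji; rewrite inE.
rewrite mem_hecke_lt blocks; last first.
  exact: (below1_down (rep_le_anti couple typeF (finF := finF))
    (@rep_le_trans _ _ _ finF)).
by split=> he j ji; apply: he; move: ji; rewrite !inE.
Qed.

End Structure.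

Theorem theorem2 (R : pzRingType) (Phi phi : mtype R) (F : lmodType R)
    (couple : symmetric_couple Phi phi) (typeF : has_type Phi F)
    (finF : finite_set [set: submodule F]%classic) :
  exists (ideal_le : forall l : types_below phi,
            two_sided_ideal (hecke_le F phi (sval l)))
         (ideal_lt : forall l : types_below phi,
            two_sided_ideal (hecke_lt F phi (sval l))),
  let H (l : types_below phi) := left_submodule (ideal_le l) in
  let K (l : types_below phi) :=
    subquotient (H l) (left_submodule (ideal_lt l)) in
  [/\ forall l : types_below phi, one_dimensional (K l),
      complete_irreducibles K &
      forall l : types_below phi,
        exists (n : nat) (mu : 'I_n -> types_below phi),
          [/\ forall i j : 'I_n, mu i = mu j -> i = j,
              forall m : types_below phi,
                mtype_le (sval m) (sval l) <-> exists i : 'I_n, mu i = m &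
              lmod_iso (H l) (direct_sum (fun i : 'I_n => K (mu i)))]].
Proof.
have [e [chi [orth eN0 sum1 eig [memH memH']]]] :=
  hecke_blocks couple typeF finF.
pose I := type_reps phi finF.
pose tb (i : I) : types_below phi := exist _ (rep_type i) (rep_type_le i).
have tbP (l : types_below phi) : exists i, tb i = l.
  case: l => l lphi; have [i il] := rep_type_surj couple typeF finF lphi.
  by exists i; apply: eq_exist.
have mulC := hecke_mulC couple typeF finF.
have annih_ideal (S : {pred hecke F phi}) (P : pred I) :
    (forall h, h \in S <-> forall j, P j -> h * e j = 0) -> two_sided_ideal S.
  move=> SP; split=> [|x a /SP xS]; last first.
    by apply/SP => j Pj; rewrite (mulC x a) -mulrA xS ?mulr0.
  split=> [|a x y /SP xS /SP yS]; apply/SP => j Pj; first exact: mul0r.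
  have axy : (a * x + y) * e j = 0.
    by rewrite mulrDl -mulrA xS // yS // mulr0 addr0.
  exact: axy.
have ideal_le (l : types_below phi) : two_sided_ideal (hecke_le F phi (sval l)).
  by have [i <-] := tbP l; apply: annih_ideal (memH i).
have ideal_lt (l : types_below phi) : two_sided_ideal (hecke_lt F phi (sval l)).
  by have [i <-] := tbP l; apply: annih_ideal (memH' i).
exists ideal_le, ideal_lt => H K.
have central (a : hecke F phi) q :
    a * hecke_scalar F phi q = hecke_scalar F phi q * a by apply: mulC.
have lineK i : char_line (hecke_scalar F phi) (K (tb i)) (chi i).
  apply: (subquotient_char_line eig).
  - apply/memH => j Nji; rewrite orth; case: eqP => // ij.
    by rewrite ij rep_le_refl in Nji.
  - apply/negP => /memH'/(_ i); rewrite eqxx orth eqxx => /(_ isT)/eqP.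
    by rewrite (negPf (eN0 i)).
  move=> t /memH tH; apply/memH' => j Nj; rewrite mulrBl -mulrA orth eq_sym.
  case: eqP Nj => [->|_] /=; first by rewrite subrr.
  by move=> Nji; rewrite mulr0 subr0 tH.
split.
- move=> l; have [i <-] := tbP l; have [v vN0 [_ vK]] := lineK i.
  by exists v.
- split.
  + by move=> l; have [i <-] := tbP l; apply: char_line_irreducible (lineK i).
  + move=> l m; have [i <-] := tbP l; have [j <-] := tbP m => ij; congr tb.
    apply: (chi_inj orth eN0 eig).
    exact: (char_line_uniq central (lineK i) (lineK j) ij).
  move=> W /(irreducible_char_line central sum1 eig)[i lineW]; exists (tb i).
  exact: (char_line_iso central lineW (lineK i)).
move=> l; have [i <-] := tbP l; pose B : {set I} := [set j | rep_le j i].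
exists #|B|, (fun k => tb (enum_val k)).
have tbI : injective tb by move=> j k /(congr1 sval) /rep_type_inj.
split.
- by move=> j k /tbI /enum_val_inj.
- move=> m; have [j <-] := tbP m; split=> [ji|[k /tbI <-]]; last first.
    by have := enum_valP k; rewrite inE => /asboolP.
  have jB : j \in B by rewrite inE; apply/asboolP.
  by exists (enum_rank_in jB j); rewrite enum_rankK_in.
apply: (block_sum_iso orth eN0 sum1 eig (mu := fun k => enum_val k)).
- exact: enum_val_inj.
- move=> h; split=> [/memH hH j NjB|hH].
    apply: hH; apply/negP => ji; have jB : j \in B by rewrite inE.
    by have := NjB (enum_rank_in jB j); rewrite enum_rankK_in // eqxx.
  apply/memH => j Nji; apply: hH => k; apply: contraNneq Nji => <-.
  by have := enum_valP k; rewrite inE.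
by move=> k; apply: lineK.
Qed.
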